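(* Assume the distributed optimization setting, the algorithm, and the noise, connectivity and loss-function assumptions described in the context. Let $\alpha(t)=\frac{\alpha_0}{(t+\tau)^{1/6}}$ and $\beta(t)=\frac{\beta_0}{(t+\tau)^{1/2}}$ for $t\ge1$ (that is, $(\nu^\star,\mu^\star)=(1/6,1/2)$), where $\alpha_0,\beta_0\in(0,1)$ and $\tau\ge0$, and let $\bar{\mathbf x}(t):=\sum_{i=1}^nr_i\mathbf x_i(t)$. Then for any $\epsilon>0$, as $T\to\infty$, $$\frac1T\sum_{t=1}^T\mathbb E\left[\|\nabla f(\bar{\mathbf x}(t))\|^2\right]\le\mathcal O\left(T^{-1/3+\epsilon}\right).$$ Furthermore, for each agent $i\in[n]$, $$\frac1T\sum_{t=1}^T\mathbb E\left[\|\mathbf x_i(t)-\bar{\mathbf x}(t)\|^2\right]\le\mathcal O\left(T^{-1/3+\epsilon}\right),$$ and, as a result, for each $i\in[n]$, $$\frac1T\sum_{t=1}^T\mathbb E\left[\|\nabla f(\mathbf x_i(t))\|^2\right]\le\mathcal O\left(T^{-1/3+\epsilon}\right).$$ The constants hidden in $\mathcal O(\cdot)$ do not depend on $T$ (they may depend on $\epsilon$ and all other parameters of the problem).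
   Context: **Problem.** Let $\ell:\mathbb R^d\times\mathbb R^p\to\mathbb R$ be a (possibly non-convex) loss function, let $\xi$ be a random vector in $\mathbb R^p$ with distribution $\mathcal P$, and let $L(\mathbf x)=\mathbb E_{\xi\sim\mathcal P}[\ell(\mathbf x,\xi)]$. Let $\mathcal D=\{\xi_1,\dots,\xi_N\}$ be $N$ independent samples from $\mathcal P$. There are $n\ge2$ agents, and $\mathcal D$ is partitioned into disjoint subsets $\mathcal D_1,\dots,\mathcal D_n$, where $\mathcal D_i=\{\xi^i_1,\dots,\xi^i_{m_i}\}$ has $m_i=r_iN$ points. Here $\mathbf r=(r_1,\dots,r_n)$ satisfies $r_i>0$ and $\sum_i r_i=1$. Define $f_i(\mathbf x)=\frac1{m_i}\sum_{j=1}^{m_i}\ell(\mathbf x,\xi^i_j)$ and $f(\mathbf x)=\sum_{i=1}^n r_if_i(\mathbf x)=\frac1N\sum_{j=1}^N\ell(\mathbf x,\xi_j)$. The goal is to minimize $f$; an optimizer $\mathbf x^\star$ of $f$ is assumed to exist, with $\mathbb E[f(\mathbf x^\star)]$ finite. Gradients of $\ell$ are with respect to its first argument. Vectors in $\mathbb R^d$ are row vectors, vectors in $\mathbb R^n$ are column vectors, and $\|\cdot\|$ is the Euclidean norm. **Algorithm (DIMIX).** Let $\{W(t)\}_{t\ge1}$ be a sequence of $n\times n$ row-stochastic matrices. Starting from $\mathbf x_i(1)=0$ for all $i\in[n]=\{1,\dots,n\}$, for $t\ge1$, $$\mathbf x_i(t+1)=(1-\beta(t))\mathbf x_i(t)+\beta(t)\hat{\mathbf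 x}_i(t)-\alpha(t)\beta(t)\nabla f_i(\mathbf x_i(t)),\qquad \hat{\mathbf x}_i(t)=\sum_{j=1}^nW_{ij}(t)\mathbf x_j(t)+\mathbf e_i(t),$$ where $\mathbf e_i(t)\in\mathbb R^d$ is a random noise vector. Let $X(t)$ be the $n\times d$ matrix with rows $\mathbf x_1(t),\dots,\mathbf x_n(t)$. The expectation $\mathbb E[\cdot]$ is over the randomness of the dataset $\mathcal D$ and of the noise. **Noise assumption.** $\{X(t)\}$ is adapted to a filtration $\{\mathcal F_t\}$ on the underlying probability space, and there is $\gamma>0$ such that for all $i\in[n]$ and $t\ge1$: $\mathbb E[\mathbf e_i(t)\mid\mathcal F_t]=0$ and $\mathbb E[\|\mathbf e_i(t)\|^2\mid\mathcal F_t]\le\gamma$. **Connectivity assumption.** (a) $W(t)$ is non-negative, $W(t)\mathbf 1=\mathbf 1$ and $\mathbf r^TW(t)=\mathbf r^T$ for all $t\ge1$, where $\mathbf 1\in\mathbb R^n$ is the all-one vector. (b) There is $\eta>0$ such that whenever $W_{ij}(t)>0$ for some $i,j\in[n]$, $t\ge1$, then $W_{ij}(t)\ge\eta$. (c) For a fixed integer $B\ge1$, the directed graph $\left([n],\bigcup_{k=t+1}^{t+B}\mathcal E(k)\right)$ is strongly connected for all $t\ge1$, where $\mathcal E(k)=\{(j,i): W_{ij}(k)>0\}$. **Loss-function assumption.** (a) $\ell$ is $K$-smooth in its first argument: $\|\nabla\ell(\mathbf x,\xi)-\nabla\ell(\mathbf y,\xi)\|\le K\|\mathbf x-\mathbf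 y\|$ for all $\mathbf x,\mathbf y\in\mathbb R^d$ and $\xi\in\mathcal D$. (b) $\mathbb E_\xi[\nabla\ell(\mathbf x,\xi)]=\nabla L(\mathbf x)$ and $\mathbb E_\xi[\|\nabla\ell(\mathbf x,\xi)-\nabla L(\mathbf x)\|^2]\le\sigma^2$ for all $\mathbf x\in\mathbb R^d$.
   Formalization: The filtration is assumed to contain the dataset from time 1, and the variance bound of the loss assumption (b) is assumed also at the iterates x_i(t) for samples of D_i, not only at each fixed x; the claim fails without either. *)

(* Defs.v *)
From HB Require Import structures.
From mathcomp Require Import all_boot all_order all_algebra.
From mathcomp Require Import all_classical all_reals all_analysis.

Set Implicit Arguments.
Unset Strict Implicit.
Unset Printing Implicit Defensive.

Import Order.TTheory GRing.Theory Num.Theory.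
Import numFieldNormedType.Exports.

Local Open Scope classical_set_scope.
Local Open Scope ring_scope.

(* 'rV[R]_n with its Borel sigma-algebra. *)
Notation borel_rV R n := (g_sigma_algebraType (@open 'rV[R]_n)).

(* The library norm on 'rV[R]_n is the sup norm; the Euclidean one is needed. *)
Definition sqnorm (R : realType) (n : nat) (v : 'rV[R]_n) : R :=
  \sum_(k < n) v 0 k ^+ 2.

Definition enorm (R : realType) (n : nat) (v : 'rV[R]_n) : R :=
  Num.sqrt (sqnorm v).

(* Meaningful where f is differentiable, which is always assumed separately. *)
Definition grad (R : realType) (n : nat) (f : 'rV[R]_n -> R) (x : 'rV[R]_n) :
    'rV[R]_n :=
  \row_(k < n) 'D_(delta_mx 0 k) f x.

(* The expected loss L(x) = E[l(x, xi)], xi ~ Pxi. *)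
Definition expected_loss (R : realType) (d p : nat)
    (l : 'rV[R]_d -> 'rV[R]_p -> R) (Pxi : probability (borel_rV R p) R)
    (x : 'rV[R]_d) : R :=
  \int[Pxi]_z l x z.

(* The partition of the data among the agents is given by the owner map
   [own : 'I_N -> 'I_n]; agent i holds the points D j with own j = i. *)
Definition shard_size (n N : nat) (own : 'I_N -> 'I_n) (i : 'I_n) : nat :=
  #|[set j | own j == i]%SET|.

Definition local_loss (R : realType) (d p n N : nat)
    (l : 'rV[R]_d -> 'rV[R]_p -> R) (own : 'I_N -> 'I_n)
    (D : 'I_N -> 'rV[R]_p) (i : 'I_n) (x : 'rV[R]_d) : R :=
  (shard_size own i)%:R^-1 * \sum_(j < N | own j == i) l x (D j).

Definition global_loss (R : realType) (d p n N : nat)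
    (l : 'rV[R]_d -> 'rV[R]_p -> R) (r : 'cV[R]_n) (own : 'I_N -> 'I_n)
    (D : 'I_N -> 'rV[R]_p) (x : 'rV[R]_d) : R :=
  \sum_(i < n) r i 0 * local_loss l own D i x.

Definition mutually_independent (dO dT : measure_display)
    (Omega : measurableType dO) (T : measurableType dT) (R : realType)
    (P : probability Omega R) (N : nat) (X : 'I_N -> Omega -> T) : Prop :=
  forall (J : {set 'I_N}) (A : 'I_N -> set T),
    (forall j, measurable (A j)) ->
    P (\bigcap_(j in [set j | j \in J]) (X j @^-1` A j)) =
    (\prod_(j in J) P (X j @^-1` A j))%E.

Definition iid_sample (dO : measure_display) (Omega : measurableType dO)
    (R : realType) (P : probability Omega R) (p N : nat)
    (Pxi : probability (borel_rV R p) R)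
    (xi : 'I_N -> {RV P >-> borel_rV R p}) : Prop :=
  mutually_independent P (fun j => xi j : Omega -> borel_rV R p) /\
  forall (j : 'I_N) (A : set (borel_rV R p)), measurable A ->
    distribution P (xi j) A = Pxi A.

Definition filtration (dO : measure_display) (Omega : measurableType dO)
    (F : nat -> set (set Omega)) : Prop :=
  [/\ forall t, sigma_algebra setT (F t),
      forall t, F t `<=` measurable
    & forall s t, (s <= t)%N -> F s `<=` F t].

(* Measurability with respect to the sub-sigma-algebra G. *)
Definition measurable_wrt (Omega : pointedType) (dT : measure_display)
    (T : measurableType dT) (G : set (set Omega)) (X : Omega -> T) : Prop :=
  measurable_fun [set: g_sigma_algebraType G] (X : g_sigma_algebraType G -> T).

(* Z is a version of E[Y | G]. *)
Definition is_cond_exp (dO : measure_display) (Omega : measurableType dO)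
    (R : realType) (P : probability Omega R) (G : set (set Omega))
    (Y Z : Omega -> R) : Prop :=
  [/\ P.-integrable setT (EFin \o Y), P.-integrable setT (EFin \o Z),
      measurable_wrt G Z
    & forall A, G A -> (\int[P]_(w in A) (Z w)%:E = \int[P]_(w in A) (Y w)%:E)%E].

Definition step_alpha (R : realType) (alpha0 tau : R) (t : nat) : R :=
  alpha0 / (t%:R + tau) `^ (1 / 6).

Definition step_beta (R : realType) (beta0 tau : R) (t : nat) : R :=
  beta0 / (t%:R + tau) `^ (1 / 2).

(* Time starts at t = 1; the values at t = 0 are irrelevant. *)
Definition dimix (R : realType) (Omega : Type) (d p n N : nat)
    (l : 'rV[R]_d -> 'rV[R]_p -> R) (own : 'I_N -> 'I_n)
    (D : Omega -> 'I_N -> 'rV[R]_p) (W : nat -> 'M[R]_n)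
    (alpha beta : nat -> R) (e : nat -> 'I_n -> Omega -> 'rV[R]_d)
    (x : nat -> 'I_n -> Omega -> 'rV[R]_d) : Prop :=
  (forall i w, x 1%N i w = 0) /\
  forall t i w, (1 <= t)%N ->
    x t.+1 i w =
      (1 - beta t) *: x t i w
      + beta t *: (\sum_(j < n) W t i j *: x t j w + e t i w)
      - (alpha t * beta t) *: grad (local_loss l own (D w) i) (x t i w).

Definition xbar (R : realType) (Omega : Type) (d n : nat) (r : 'cV[R]_n)
    (x : nat -> 'I_n -> Omega -> 'rV[R]_d) (t : nat) (w : Omega) : 'rV[R]_d :=
  \sum_(i < n) r i 0 *: x t i w.

(* The history F t carries the data set as well as X(t): the gradients
   grad f_i (x_i(t)) are part of the past when the noise e_i(t) is drawn.
   If F t were only generated by X(1), ..., X(t), then e_i(t) could be a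
   function of the data that cancels the gradient step, and the iterates
   would learn nothing. *)
Definition noise_assumption (dO : measure_display) (Omega : measurableType dO)
    (R : realType) (P : probability Omega R) (d p n N : nat)
    (xi : 'I_N -> {RV P >-> borel_rV R p}) (F : nat -> set (set Omega))
    (x e : nat -> 'I_n -> Omega -> 'rV[R]_d) (gamma : R) : Prop :=
  [/\ filtration F,
      forall j, measurable_wrt (F 1%N) (xi j : Omega -> borel_rV R p),
      forall t i, (1 <= t)%N ->
        measurable_wrt (F t) (x t i : Omega -> borel_rV R d),
      forall t i (k : 'I_d), (1 <= t)%N ->
        is_cond_exp P (F t) (fun w => e t i w 0 k) (cst 0)
    & 0 < gamma /\
      forall t i, (1 <= t)%N ->
        exists2 Z : Omega -> R,
          is_cond_exp P (F t) (fun w => sqnorm (e t i w)) Z &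
          {ae P, forall w, Z w <= gamma}].

(* The edge relation of the union of E(t+1), ..., E(t+B), where E(k) has an
   edge from j to i when W_ij(k) > 0. *)
Definition window_edge (R : realType) (n : nat) (W : nat -> 'M[R]_n)
    (B t : nat) : rel 'I_n :=
  fun j i => has (fun k => 0 < W k i j) (index_iota t.+1 (t + B).+1).

Definition connectivity_assumption (R : realType) (n : nat) (r : 'cV[R]_n)
    (W : nat -> 'M[R]_n) (eta : R) (B : nat) : Prop :=
  [/\ forall t, (1 <= t)%N ->
        [/\ forall i j, 0 <= W t i j,
            W t *m const_mx 1 = const_mx 1 :> 'cV[R]_n
          & r^T *m W t = r^T],
      0 < eta /\
      forall t i j, (1 <= t)%N -> 0 < W t i j -> eta <= W t i j
    & (1 <= B)%N /\
      forall t, (1 <= t)%N -> forall i j, connect (window_edge W B t) i j].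

(* The first three clauses say that L and the gradients are well defined.
   The last one is the variance bound at the points where the algorithm
   evaluates the gradients.  These depend on the sample, so it does not
   follow from the bound at each fixed x (a gradient deviation located at a
   data-dependent place is rare at every fixed x, yet the iterates can be
   driven there), and the rates fail without it. *)
Definition loss_assumption (dO : measure_display) (Omega : measurableType dO)
    (R : realType) (P : probability Omega R) (d p n N : nat)
    (l : 'rV[R]_d -> 'rV[R]_p -> R) (Pxi : probability (borel_rV R p) R)
    (own : 'I_N -> 'I_n) (xi : 'I_N -> {RV P >-> borel_rV R p})
    (x : nat -> 'I_n -> Omega -> 'rV[R]_d) (K sigma : R) : Prop :=
  let L := expected_loss l Pxi in
  [/\ forall y, Pxi.-integrable setT (fun z => (l y z)%:E),
      forall y z, differentiable (fun u => l u z) y,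
      forall y, differentiable L y,
      forall w j y y',
        enorm (grad (fun u => l u (xi j w)) y - grad (fun u => l u (xi j w)) y')
          <= K * enorm (y - y')
    & [/\ forall y (k : 'I_d),
            ('E_Pxi[fun z => (grad (fun u => l u z) y 0 k)%R]
               = (grad L y 0 k)%:E)%E,
          forall y,
            ('E_Pxi[fun z => (sqnorm (grad (fun u => l u z) y - grad L y))%R]
               <= (sigma ^+ 2)%:E)%E
        & forall t i j, (1 <= t)%N -> own j = i ->
            ('E_P[fun w => (sqnorm (grad (fun u => l u (xi j w)) (x t i w)
                                    - grad L (x t i w)))%R]
               <= (sigma ^+ 2)%:E)%E]].

Definition time_average (dO : measure_display) (Omega : measurableType dO)
    (R : realType) (P : probability Omega R) (Y : nat -> Omega -> R) (T : nat) :
    \bar R :=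
  ((T%:R^-1)%:E * \sum_(1 <= t < T.+1) 'E_P[Y t])%E.

(* u T <= O(v T) as T goes to infinity. *)
Definition is_bigO (R : realType) (u : nat -> \bar R) (v : nat -> R) : Prop :=
  exists C : R, \forall T \near \oo, (u T <= (C * v T)%:E)%E.

(* Main.v *)
Require Import Defs.
From HB Require Import structures.
From mathcomp Require Import all_boot all_order all_algebra.
From mathcomp Require Import all_classical all_reals all_analysis.
From mathcomp Require Import measurable_realfun.
From mathcomp Require Import ring lra zify.

Set Implicit Arguments.
Unset Strict Implicit.
Unset Printing Implicit Defensive.

Import Order.TTheory GRing.Theory Num.Theory.
Import numFieldNormedType.Exports.

Local Open Scope classical_set_scope.
Local Open Scope ring_scope.

(** The proof bounds two mean-square quantities: the dispersion [U t] of the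
    agents around their weighted average, and the squared gradient [Gn t] of
    the objective at that average.  Instead of estimating them at each time,
    one sums their products with the weight [alpha t * beta t], which is of
    order [t `^ (- 2 / 3)].  Both weighted sums up to [T] grow at
    most like the sum of [alpha t ^+ 3 * beta t], whose terms are of order
    [1 / t], that is, like [ln T].  Dividing by the smallest weight costs a
    factor [T `^ (2 / 3)], and the averages are of order
    [T `^ (- 1 / 3) * ln T], where the logarithm is absorbed by the power
    [eps] ([average_rate]).

    Dispersion.  Since [r] is stationary for the mixing matrices, Jensen's
    inequality shows that a mixing step with weight [beta] decreases the
    dispersion by about [beta] times the disagreement along the links that are
    present, while the noise adds a term of order [beta ^+ 2] and the gradients
    one of order [alpha ^+ 2 * beta] ([dispersion_step]).  The links of one time
    need not connect the agents, but those of a window of length [B] do, and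
    then the disagreements of the window control the dispersion at its end, up
    to the small distance covered within the window ([dispersion_le_window],
    [dispersion_window_le]).  Multiplied by [alpha t] the one-step inequality
    telescopes, and trading disagreement for dispersion closes the estimate
    ([summed_dispersion_le]).

    Gradients.  The gradients of the agents are compared with the gradient of
    the expected loss at the average.  Their deviation comes from the sampling
    variance at the iterates and from the distance to the average, because the
    gradient of the expected loss, being the expectation of the gradient at one
    sample point, is Lipschitz too.

    Descent.  Mixing leaves the weighted average unchanged, so that the average
    follows a perturbed gradient descent for [f].  The descent inequality for
    smooth functions ([smooth_descent]) telescopes, as [f] is bounded below by
    its value at [xstar].

    Probability.  Both parts use that the noise is orthogonal to every
    square-integrable random variable known beforehand ([cond_exp0_orth]).
    That the gradients at the random iterates are such variables follows from
    a composition result for functions that are measurable in one variable and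
    continuous in the other ([measurable_caratheodory_comp]). *)

(** * Measurability of compositions *)

(** Rounding [X] to the grid of mesh [1 / (m + 1)] leaves countably many values,
    and on the event that a given value [q] is taken the composition is the
    measurable function [H q]; continuity passes to the limit in [m]. *)
Lemma measurable_caratheodory_comp (dT : measure_display)
    (T : measurableType dT) (R : realType) (n : nat)
    (H : 'rV[R]_n -> T -> R) (X : T -> 'rV[R]_n) :
  (forall y, measurable_fun setT (H y)) ->
  (forall w, continuous (H^~ w)) ->
  (forall k, measurable_fun setT (fun w => X w 0 k)) ->
  measurable_fun setT (fun w => H (X w) w).
Proof.
move=> mH cH mX.
pose cell (m : nat) w : 'rV[int]_n := \row_k Num.floor (X w 0 k * m.+1%:R).
pose pt (m : nat) (q : 'rV[int]_n) : 'rV[R]_n := \row_k ((q 0 k)%:~R / m.+1%:R).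
have mcell m q : measurable [set w | cell m w = q].
  have -> : [set w | cell m w = q] =
      \bigcap_(k in [set: 'I_n]) [set w | Num.floor (X w 0 k * m.+1%:R) = q 0 k].
    apply/seteqP; split=> [w /= <- k _ /=|w Hw]; first by rewrite mxE.
    by apply/rowP => k; rewrite mxE; exact: Hw.
  apply: fin_bigcap_measurable => [|k _]; first exact: finite_finset.
  have -> : [set w | Num.floor (X w 0 k * m.+1%:R) = q 0 k] =
    (fun w => X w 0 k * m.+1%:R) @^-1` `[(q 0 k)%:~R, (q 0 k + 1)%:~R[%classic.
    apply/seteqP; split=> w /=; rewrite in_itv/=.
      by move=> <-; exact: floor_itv.
    by move=> h; apply/eqP; rewrite floor_eq.
  rewrite -[X in measurable X]setTI.
  by apply: measurable_realfun.measurable_funM (mX k) (measurable_cst _) _ _ _.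
apply: (@measurable_fun_cvg _ _ _ _ (fun m w => H (pt m (cell m w)) w)).
  move=> m _ Y mY; rewrite setTI.
  have -> : (fun w => H (pt m (cell m w)) w) @^-1` Y =
    \bigcup_(q in [set: 'rV[int]_n])
      ([set w | cell m w = q] `&` (H (pt m q) @^-1` Y)).
    apply/seteqP; split=> [w /= Hw|w [q _ [/= <-]]//].
    by exists (cell m w).
  apply: countable_bigcupT_measurable => [|q].
    exact: countableP.
  apply: measurableI => //.
  by rewrite -[X in measurable X]setTI; exact: mH.
move=> w _.
apply: (@continuous_cvg _ _ _ _ _ (fun m => pt m (cell m w)) (H^~ w)).
  exact: cH.
apply/cvg_ballP => e e0.
near=> m.
split=> // i k; rewrite !mxE ord1.
have m0 : 0 < m.+1%:R :> R by rewrite ltr0n.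
have me : m.+1%:R^-1 < e.
  by near: m; exact: (near_infty_natSinv_lt (PosNum e0)).
rewrite -ball_normE /=.
have /andP[h1 h2] := floor_itv (X w 0 k * m.+1%:R).
apply: le_lt_trans me.
set y := X w 0 k in h1 h2 *; set z := (Num.floor _)%:~R in h1 h2 *.
have -> : y - z / m.+1%:R = (y * m.+1%:R - z) * m.+1%:R^-1.
  by rewrite mulrBl mulfK ?gt_eqF.
rewrite normrM [X in _ * X]gtr0_norm ?invr_gt0// ler_piMl ?invr_ge0// ltW//.
by move: h2; rewrite intrD -/z ltr_norml => h2; apply/andP; split; lra.
Unshelve. all: by end_near.
Qed.

(** * Integrability and conditional expectation *)

Section integrability.
Import HBNNSimple.
Context (dO : measure_display) (Omega : measurableType dO) (R : realType)
  (P : probability Omega R).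
Implicit Types (f g h : Omega -> R).

Definition L1 f := P.-integrable setT (EFin \o f).
Definition L2 f := measurable_fun setT f /\ L1 (fun w => f w ^+ 2).
Definition Ex f : R := \int[P]_w f w.

Lemma L1_measurable f : L1 f -> measurable_fun setT f.
Proof. by move=> /measurable_int /measurable_EFinP. Qed.

Lemma L1_eq f g : f =1 g -> L1 f -> L1 g.
Proof. by move=> fg; apply: eq_integrable => // w _ /=; rewrite fg. Qed.

Lemma Ex_eq f g : f =1 g -> Ex f = Ex g.
Proof. by move=> fg; apply: eq_Rintegral => w _; exact: fg. Qed.

Lemma L1_le f g : measurable_fun setT f -> L1 g ->
  (forall w, `|f w| <= g w) -> L1 f.
Proof.
move=> mf ig fg; apply: le_integrable ig => //; first exact/measurable_EFinP.
by move=> w _ /=; rewrite lee_fin (le_trans (fg w))// ler_norm.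
Qed.

Lemma L1_cst c : L1 (fun=> c).
Proof. exact: finite_measure_integrable_cst. Qed.

Lemma L1D f g : L1 f -> L1 g -> L1 (fun w => f w + g w).
Proof. by move=> lf lg; exact: integrableD lf lg. Qed.

Lemma L1Z c f : L1 f -> L1 (fun w => c * f w).
Proof. by move=> lf; exact: integrableZl lf. Qed.

Lemma L1B f g : L1 f -> L1 g -> L1 (fun w => f w - g w).
Proof. by move=> lf lg; exact: integrableB lf lg. Qed.

Lemma L1_norm f : L1 f -> L1 (fun w => `|f w|).
Proof. exact: integrable_norm. Qed.

Lemma L1_sum I (s : seq I) (Q : pred I) (f : I -> Omega -> R) :
  (forall i, Q i -> L1 (f i)) -> L1 (fun w => \sum_(i <- s | Q i) f i w).
Proof.
move=> lf; elim: s => [|i s IH].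
  by apply: L1_eq (L1_cst 0) => w; rewrite big_nil.
have [Qi|nQi] := boolP (Q i).
  by apply: L1_eq (L1D (lf i Qi) IH) => w; rewrite big_cons Qi.
by apply: L1_eq IH => w; rewrite big_cons (negbTE nQi).
Qed.

Lemma Ex_cst c : Ex (fun=> c) = c.
Proof.
by rewrite /Ex Rintegral_cst// [X in fine X]probability_setT mulr1.
Qed.

Lemma ExD f g : L1 f -> L1 g -> Ex (fun w => f w + g w) = Ex f + Ex g.
Proof. exact: RintegralD. Qed.

Lemma ExZ c f : L1 f -> Ex (fun w => c * f w) = c * Ex f.
Proof. exact: RintegralZl. Qed.

Lemma ExB f g : L1 f -> L1 g -> Ex (fun w => f w - g w) = Ex f - Ex g.
Proof. exact: RintegralB. Qed.

Lemma Ex_sum I (s : seq I) (Q : pred I) (f : I -> Omega -> R) :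
  (forall i, Q i -> L1 (f i)) ->
  Ex (fun w => \sum_(i <- s | Q i) f i w) = \sum_(i <- s | Q i) Ex (f i).
Proof.
move=> lf; elim: s => [|i s IH].
  by rewrite big_nil -[RHS](Ex_cst 0); apply: Ex_eq => w; rewrite big_nil.
rewrite big_cons -IH; case: ifPn => Qi.
  rewrite -ExD; [|exact: lf|exact: L1_sum].
  by apply: Ex_eq => w; rewrite big_cons Qi.
by apply: Ex_eq => w; rewrite big_cons (negbTE Qi).
Qed.

Lemma Ex_le f g : L1 f -> L1 g -> (forall w, f w <= g w) -> Ex f <= Ex g.
Proof. by move=> lf lg fg; apply: le_Rintegral. Qed.

Lemma Ex_ge0 f : (forall w, 0 <= f w) -> 0 <= Ex f.
Proof. by move=> f0; apply: Rintegral_ge0. Qed.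

Lemma Ex_EFin f : L1 f -> ('E_P[f] = (Ex f)%:E)%E.
Proof.
by move=> lf; rewrite unlock /Ex /Rintegral fineK//; exact: integrable_fin_num.
Qed.

Lemma L2_sqr f : L2 f -> L1 (fun w => f w ^+ 2).
Proof. by case. Qed.

Lemma L2_le f g : measurable_fun setT f -> L1 g ->
  (forall w, f w ^+ 2 <= g w) -> L2 f.
Proof.
move=> mf lg fg; split=> //; apply: L1_le lg _ => [|w].
  exact: measurable_funX.
by rewrite ger0_norm ?sqr_ge0.
Qed.

Lemma L2_eq f g : f =1 g -> L2 f -> L2 g.
Proof. by move=> /funext ->. Qed.

Lemma L2_cst c : L2 (fun=> c).
Proof. by split; [exact: measurable_cst|exact: L1_cst]. Qed.

Lemma L2_mul f g : L2 f -> L2 g -> L1 (fun w => f w * g w).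
Proof.
move=> [mf lf] [mg lg]; apply: L1_le (L1D lf lg) _ => [|w].
  exact: measurable_funM.
rewrite normrM -(real_normK (num_real (f w))) -(real_normK (num_real (g w))).
by have := sqr_ge0 (`|f w| - `|g w|); have := normr_ge0 (f w);
  have := normr_ge0 (g w); nra.
Qed.

Lemma L2D f g : L2 f -> L2 g -> L2 (fun w => f w + g w).
Proof.
move=> [mf lf] [mg lg].
apply: L2_le (L1D (L1Z 2 lf) (L1Z 2 lg)) _ => [|w]; first exact: measurable_funD.
by have := sqr_ge0 (f w - g w); nra.
Qed.

Lemma L2Z c f : L2 f -> L2 (fun w => c * f w).
Proof.
move=> [mf lf]; apply: L2_le (L1Z (c ^+ 2) lf) _ => [|w].
  exact: measurable_funM.
by rewrite exprMn.
Qed.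

Lemma L2B f g : L2 f -> L2 g -> L2 (fun w => f w - g w).
Proof.
by move=> lf lg; apply: L2_eq (L2D lf (L2Z (-1) lg)) => w; rewrite mulN1r.
Qed.

Lemma L2_sum I (s : seq I) (Q : pred I) (f : I -> Omega -> R) :
  (forall i, Q i -> L2 (f i)) -> L2 (fun w => \sum_(i <- s | Q i) f i w).
Proof.
move=> lf; elim: s => [|i s IH].
  by apply: L2_eq (L2_cst 0) => w; rewrite big_nil.
have [Qi|nQi] := boolP (Q i).
  by apply: L2_eq (L2D (lf i Qi) IH) => w; rewrite big_cons Qi.
by apply: L2_eq IH => w; rewrite big_cons (negbTE nQi).
Qed.

Lemma measurable_wrt_measurable dT (T : measurableType dT)
    (G : set (set Omega)) (X : Omega -> T) :
  sigma_algebra setT G -> G `<=` measurable -> measurable_wrt G X ->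
  measurable_fun setT X.
Proof.
move=> sG subG mX _ Y mY.
have := mX measurableT Y mY; rewrite !setTI => h.
by apply: subG; rewrite -(sigma_algebra_id sG).
Qed.

Lemma measurable_wrt_sub dT (T : measurableType dT)
    (G G' : set (set Omega)) (X : Omega -> T) :
  G `<=` G' -> measurable_wrt G X -> measurable_wrt G' X.
Proof.
move=> subG mX _ Y mY; have := mX measurableT Y mY.
exact: sub_smallest2r.
Qed.

Let orth_ge0 (G : set (set Omega)) (h e : Omega -> R) :
  sigma_algebra setT G -> G `<=` measurable ->
  is_cond_exp P G e (cst 0) -> measurable_wrt G h -> (forall w, 0 <= h w) ->
  L1 (fun w => h w * e w) -> Ex (fun w => h w * e w) = 0.
Proof.
move=> sG subG [le _ _ e0] mh h0 lhe.
have mh' : measurable_fun [set: g_sigma_algebraType G]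
    (EFin \o h : g_sigma_algebraType G -> \bar R) by exact/measurable_EFinP.
have := approximation (measurableT : measurable [set: g_sigma_algebraType G]) mh'.
case=> [w _|s [nds cvs]]; first by rewrite lee_fin h0.
have mwrt f : measurable_wrt G f -> measurable_fun setT f.
  exact: measurable_wrt_measurable.
have cvs' w : s^~ w @ \oo --> h w.
  by have := cvs w I; move/fine_cvg; apply.
have sh m (w : Omega) : s m w <= h w.
  have nd : nondecreasing_seq (s^~ w) by move=> a b /nds /lefP; exact.
  have cs : cvgn (s^~ w) by apply/cvg_ex; exists (h w).
  by have := nondecreasing_cvgn_le nd cs m; rewrite (cvg_lim _ (cvs' w)).
have ms m : measurable_fun setT (s m : Omega -> R).
  by apply: mwrt; exact: measurable_funP.
have mse m : measurable_fun setT (fun w : Omega => s m w * e w).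
  apply: measurable_funM => //. exact: (L1_measurable le).
have ind0 A : G A -> Ex (fun w => \1_A w * e w) = 0.
  move=> GA; rewrite /Ex /Rintegral.
  have -> : (\int[P]_w (\1_A w * e w)%:E = \int[P]_(w in A) (e w)%:E)%E.
    rewrite [RHS]integral_mkcond; apply: eq_integral => w _.
    by rewrite patchE indicE; case: ifP => _; rewrite ?mul1r ?mul0r.
  by rewrite -(e0 A GA) integral0_eq.
have Es m : Ex (fun w : Omega => s m w * e w) = 0.
  transitivity (Ex (fun w : Omega =>
      \sum_(y <- finmap.enum_fset (fset_set (range (s m))))
        y * (\1_(s m @^-1` [set y]) w * e w))).
    apply: Ex_eq => w; rewrite {1}(fimfunE (s m) w) fsbig_finite//= mulr_suml.
    by apply: eq_bigr => y _; rewrite mulrA.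
  have GA y : G (s m @^-1` [set y]).
    have : <<s G >> (s m @^-1` [set y]).
      exact: (measurable_funPTI (s m) (measurable_set1 y)).
    by rewrite (sigma_algebra_id sG).
  have lA y : L1 (fun w : Omega => \1_(s m @^-1` [set y]) w * e w).
    apply: L1_le (L1_norm le) _ => [|w].
      apply: measurable_funM; last exact: L1_measurable le.
      exact/measurable_indicP/subG/GA.
    rewrite normrM ler_piMl// indicE; case: (_ \in _); by rewrite ?normr1 ?normr0.
  rewrite Ex_sum => [|y _]; last exact: L1Z.
  by apply: big1 => y _; rewrite ExZ// ind0 ?mulr0.
have [] := @dominated_convergence _ _ _ P setT measurableT
  (fun m (w : Omega) => (s m w * e w)%:E) (fun w : Omega => (h w * e w)%:E)
  (fun w => `|h w * e w|%:E).
- by move=> m; exact/measurable_EFinP.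
- exact/measurable_EFinP/L1_measurable.
- apply: aeW => w _; apply: cvg_EFin; first by near=> x.
  exact: cvgMl.
- exact: L1_norm.
- apply: aeW => w m _ /=; rewrite lee_fin !normrM ler_wpM2r//.
  by rewrite !ger0_norm.
move=> _ _ /=.
have sE m : (\int[P]_w ((fun w : Omega => s m w * e w) w)%:E = 0)%E.
  rewrite -[LHS]fineK; last first.
    apply: integrable_fin_num => //; apply: L1_le (L1_norm lhe) _ => // w.
    by rewrite !normrM ler_wpM2r// !ger0_norm.
  by rewrite [fine _](Es m).
under eq_fun do rewrite sE.
move=> c0; rewrite /Ex /Rintegral -(cvg_lim _ c0)//.
by rewrite (cvg_lim _ (cvg_cst 0%E)).
Unshelve. all: by end_near.
Qed.

(** The simple functions that increase to a nonnegative [h] are combinations of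
    indicators of events of [G], on which [e] averages to zero; dominated
    convergence passes to the limit, and the sign of [h] is dealt with
    by splitting it into positive and negative parts. *)
Lemma cond_exp0_orth (G : set (set Omega)) (h e : Omega -> R) :
  sigma_algebra setT G -> G `<=` measurable ->
  is_cond_exp P G e (cst 0) -> measurable_wrt G h ->
  L1 (fun w => h w * e w) -> Ex (fun w => h w * e w) = 0.
Proof.
move=> sG subG ce mh lhe.
have me : measurable_fun setT e by case: ce => /L1_measurable.
have part (h' : Omega -> R) : measurable_wrt G h' -> (forall w, 0 <= h' w) ->
    (forall w, h' w <= `|h w|) ->
    L1 (fun w => h' w * e w) /\ Ex (fun w => h' w * e w) = 0.
  move=> mh' h'0 h'h.
  suff lh' : L1 (fun w => h' w * e w) by split=> //; exact: orth_ge0 mh' _ lh'.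
  apply: L1_le (L1_norm lhe) _ => [|w].
    by apply: measurable_funM => //; exact: measurable_wrt_measurable mh'.
  by rewrite !normrM ler_wpM2r// ger0_norm.
have [lp Ep] : L1 (fun w => h^\+ w * e w) /\ Ex (fun w => h^\+ w * e w) = 0.
  apply: part => [|w|w]; first exact: measurable_funrpos.
    exact: funrpos_ge0.
  by rewrite /funrpos ge_max ler_norm normr_ge0.
have [ln En] : L1 (fun w => h^\- w * e w) /\ Ex (fun w => h^\- w * e w) = 0.
  apply: part => [|w|w]; first exact: measurable_funrneg.
    exact: funrneg_ge0.
  by rewrite /funrneg ge_max normr_ge0 andbT -normrN ler_norm.
have -> : Ex (fun w => h w * e w) = Ex (fun w => h^\+ w * e w - h^\- w * e w).
  by apply: Ex_eq => w; rewrite -mulrBl -[in LHS](funrposBneg h).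
by rewrite ExB// Ep En subrr.
Qed.

End integrability.

(** * Weighted means, Euclidean vectors and gradients *)

Section weighted_means.
Context (R : realType) (I : finType) (p : I -> R).
Hypotheses (p_ge0 : forall i, 0 <= p i) (p_sum1 : \sum_i p i = 1).

Lemma wmean_bias_variance (a : I -> R) (c : R) :
  \sum_i p i * (a i - c) ^+ 2 =
    \sum_i p i * (a i - \sum_j p j * a j) ^+ 2 + (\sum_j p j * a j - c) ^+ 2.
Proof.
set m := \sum_j p j * a j.
have -> : \sum_i p i * (a i - c) ^+ 2 =
    \sum_i (p i * (a i - m) ^+ 2 + (2 * (m - c)) * (p i * a i)
            + (c ^+ 2 - m ^+ 2) * p i).
  by apply: eq_bigr => i _; ring.
by rewrite !big_split/= -!mulr_sumr p_sum1 -/m; ring.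
Qed.

Lemma wmean_variance_min (a : I -> R) (c : R) :
  \sum_i p i * (a i - \sum_j p j * a j) ^+ 2 <= \sum_i p i * (a i - c) ^+ 2.
Proof. by rewrite [leRHS]wmean_bias_variance lerDl sqr_ge0. Qed.

Lemma sqr_wmean_le (a : I -> R) :
  (\sum_i p i * a i) ^+ 2 <= \sum_i p i * a i ^+ 2.
Proof.
have := wmean_bias_variance a 0.
under eq_bigr do rewrite subr0.
rewrite subr0 => ->; rewrite lerDr sumr_ge0// => i _.
by rewrite mulr_ge0 ?sqr_ge0.
Qed.

End weighted_means.

Section euclidean.
Context (R : realType) (n : nat).
Implicit Types (u v y : 'rV[R]_n) (f : 'rV[R]_n -> R).

Definition dotv u v : R := \sum_(k < n) u 0 k * v 0 k.

Lemma sqnorm_ge0 u : 0 <= sqnorm u.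
Proof. by apply: sumr_ge0 => k _; exact: sqr_ge0. Qed.

Lemma sqr_coord_le u k : u 0 k ^+ 2 <= sqnorm u.
Proof.
by rewrite /sqnorm (bigD1 k)//= lerDl sumr_ge0// => j _; exact: sqr_ge0.
Qed.

Lemma rowB_coord u v k : (u - v) 0 k = u 0 k - v 0 k.
Proof. by rewrite !mxE. Qed.

Lemma sqr_le_dist (a b c : R) : (a - b) ^+ 2 <= c -> a ^+ 2 <= 2 * c + 2 * b ^+ 2.
Proof. by move=> h; have := sqr_ge0 (a - 2 * b); lra. Qed.

Lemma sqnormZ a u : sqnorm (a *: u) = a ^+ 2 * sqnorm u.
Proof.
by rewrite /sqnorm mulr_sumr; apply: eq_bigr => k _; rewrite mxE exprMn.
Qed.

Lemma sqnormD_le u v : sqnorm (u + v) <= 2 * sqnorm u + 2 * sqnorm v.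
Proof.
rewrite /sqnorm !mulr_sumr -big_split/=; apply: ler_sum => k _; rewrite mxE.
by have := sqr_ge0 (u 0 k - v 0 k); nra.
Qed.

Lemma sqnormBC u v : sqnorm (u - v) = sqnorm (v - u).
Proof. by apply: eq_bigr => k _; rewrite !mxE -sqrrN opprB. Qed.

Lemma sqnorm_wmean_le (I : finType) (p : I -> R) (V : I -> 'rV[R]_n) :
  (forall i, 0 <= p i) -> \sum_i p i = 1 ->
  sqnorm (\sum_i p i *: V i) <= \sum_i p i * sqnorm (V i).
Proof.
move=> p0 p1; rewrite /sqnorm.
under [leRHS]eq_bigr do rewrite mulr_sumr.
rewrite exchange_big/=; apply: ler_sum => k _.
rewrite summxE; under [X in X ^+ 2]eq_bigr do rewrite mxE.
exact: sqr_wmean_le.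
Qed.

Lemma dotvDr u v v' : dotv u (v + v') = dotv u v + dotv u v'.
Proof.
by rewrite /dotv -big_split/=; apply: eq_bigr => k _; rewrite mxE mulrDr.
Qed.

Lemma dotvZr a u v : dotv u (a *: v) = a * dotv u v.
Proof.
by rewrite /dotv mulr_sumr; apply: eq_bigr => k _; rewrite mxE mulrCA.
Qed.

Lemma dotvBl u u' v : dotv (u - u') v = dotv u v - dotv u' v.
Proof.
rewrite /dotv -sumrB; apply: eq_bigr => k _; rewrite !mxE; ring.
Qed.

Lemma dotv_young u v : `|dotv u v| <= (sqnorm u + sqnorm v) / 2.
Proof.
have -> : (sqnorm u + sqnorm v) / 2 =
    \sum_k (u 0 k ^+ 2 + v 0 k ^+ 2) / 2.
  by rewrite -mulr_suml big_split.
apply: le_trans (ler_norm_sum _ _ _) _; apply: ler_sum => k _.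
rewrite normrM -(real_normK (num_real (u 0 k))) -(real_normK (num_real (v 0 k))).
by have := sqr_ge0 (`|u 0 k| - `|v 0 k|); nra.
Qed.

Lemma dotv_polar u v :
  dotv u v = (sqnorm u + sqnorm v - sqnorm (u - v)) / 2.
Proof.
rewrite /dotv /sqnorm -big_split -sumrB mulr_suml /=.
by apply: eq_bigr => k _; rewrite !mxE; field.
Qed.

Lemma enorm_le_sqnorm (K : R) u v :
  enorm u <= K * enorm v -> sqnorm u <= K ^+ 2 * sqnorm v.
Proof.
move=> h; rewrite -(sqr_sqrtr (sqnorm_ge0 u)) -(sqr_sqrtr (sqnorm_ge0 v)).
by rewrite -exprMn lerXn2r ?nnegrE ?(le_trans _ h) ?sqrtr_ge0.
Qed.

(** Neighbourhoods of row vectors are those of the sup norm, whence the dimension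
    in the radius. *)
Lemma sqr_lipschitz_continuous (C : R) f :
  (forall y y', (f y - f y') ^+ 2 <= C * sqnorm (y - y')) -> continuous f.
Proof.
move=> fC y; apply: (iffRL (@cvg_ballP R R _ (nbhs y) _ f (f y))) => e e0.
pose a := `|C| * n%:R + 1.
have a1 : 1 <= a by rewrite lerDr mulr_ge0.
have a0 : 0 < a by exact: lt_le_trans a1.
apply/nbhs_ballP; exists (e / a); first by rewrite /= divr_gt0.
move=> z [_ yz]; rewrite /= -ball_normE /=.
rewrite -(@ltr_pXn2r _ 2)// ?nnegrE// ?(ltW e0)// real_normK ?num_real//.
apply: le_lt_trans (fC _ _) _.
apply: (@le_lt_trans _ _ (`|C| * (n%:R * (e / a) ^+ 2))).
  apply: le_trans (_ : `|C| * sqnorm (y - z) <= _).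
    by rewrite ler_wpM2r ?sqnorm_ge0// ler_norm.
  rewrite ler_wpM2l// /sqnorm.
  have -> : n%:R * (e / a) ^+ 2 = \sum_(k < n) (e / a) ^+ 2.
    by rewrite sumr_const card_ord mulr_natl.
  apply: ler_sum => k _; rewrite !mxE.
  have := yz 0 k; rewrite -ball_normE /= => /ltW h.
  rewrite -[leLHS]real_normK ?num_real//.
  by rewrite lerXn2r ?nnegrE ?divr_ge0 ?(ltW e0) ?(ltW a0).
have -> : `|C| * (n%:R * (e / a) ^+ 2) = (`|C| * n%:R / a ^+ 2) * e ^+ 2.
  by field; rewrite gt_eqF.
rewrite gtr_pMl ?exprn_gt0// ltr_pdivrMr ?exprn_gt0// mul1r.
apply: (@lt_le_trans _ _ a); first by rewrite ltrDl.
by rewrite expr2 ler_peMl// ltW.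
Qed.

End euclidean.

Section gradient.
Context (R : realType) (n : nat).
Implicit Types (u v y : 'rV[R]_n) (f : 'rV[R]_n -> R).

Lemma derive_dotv f y v : differentiable f y -> 'D_v f y = dotv (grad f y) v.
Proof.
move=> df; rewrite deriveE// {1}(row_sum_delta v) linear_sum /dotv.
by apply: eq_bigr => k _; rewrite linearZ/= mxE deriveE// mulrC.
Qed.

Lemma line_is_derive f y v (s : R) :
  differentiable f (y + s *: v) ->
  is_derive s 1 (fun t => f (y + t *: v)) (dotv (grad f (y + s *: v)) v).
Proof.
move=> df; rewrite -derive_dotv//.
have E : (fun h : R => h^-1 *: (((fun t => f (y + t *: v)) \o shift s) (h *: 1)
            - f (y + s *: v))) =
         (fun h : R => h^-1 *: ((f \o shift (y + s *: v)) (h *: v)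
            - f (y + s *: v))).
  apply/funext => h /=; congr (_ *: (f _ - _)).
  by rewrite /= [h *: 1]mulr1 scalerDl addrCA.
split; first by rewrite /derivable E; exact: diff_derivable.
by rewrite /derive E.
Qed.

(** The mean value theorem along the segment from [y] to [y + v]; between its
    ends the gradient moves by at most the Lipschitz bound. *)
Lemma smooth_taylor (H : R) f y v :
  0 <= H -> (forall z, differentiable f z) ->
  (forall z z', sqnorm (grad f z - grad f z') <= H * sqnorm (z - z')) ->
  `|f (y + v) - f y - dotv (grad f y) v| <= (H + 1) / 2 * sqnorm v.
Proof.
move=> H0 df gl.
have dline (s : R) := line_is_derive (df (y + s *: v)).
have [|c c01] := @MVT R (fun t => f (y + t *: v))
    (fun t => dotv (grad f (y + t *: v)) v) 0 1 ltr01 (fun s _ => dline s).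
  apply: continuous_subspaceT => s; apply: differentiable_continuous.
  by apply/derivable1_diffP; case: (dline s).
rewrite scale1r scale0r addr0 subr0 mulr1 => ->.
rewrite -dotvBl; apply: le_trans (dotv_young _ _) _.
have : sqnorm (grad f (y + c *: v) - grad f y) <= H * sqnorm v.
  apply: le_trans (gl _ _) _; rewrite addrC addKr sqnormZ.
  rewrite ler_wpM2l// ler_piMl ?sqnorm_ge0//.
  by move: c01; rewrite in_itv/= => /andP[c0 c1]; rewrite expr_le1 ?ltW.
have := sqnorm_ge0 v; lra.
Qed.

(** One step along a perturbed direction [q] close to the gradient: the cross term
    is polarized, so that it yields a decrease proportional to the squared
    gradient and a negative multiple of [sqnorm q]. *)
Lemma smooth_descent (H : R) f y (e q : 'rV[R]_n) (al b D : R) :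
  0 <= H -> (forall z, differentiable f z) ->
  (forall z z', sqnorm (grad f z - grad f z') <= H * sqnorm (z - z')) ->
  0 <= al * b -> sqnorm (grad f y - q) <= D ->
  al * b * sqnorm (grad f y) <=
    2 * (f y - f (y + (b *: e - (al * b) *: q))) + 2 * b * dotv (grad f y) e
    + al * b * D + 2 * (H + 1) * b ^+ 2 * sqnorm e
    + (2 * (H + 1) * (al * b) ^+ 2 - al * b) * sqnorm q.
Proof.
move=> H0 df gl ab0 hD; set v := b *: e - (al * b) *: q.
have := smooth_taylor y v H0 df gl; rewrite ler_norml => /andP[_].
have -> : dotv (grad f y) v = b * dotv (grad f y) e
    - al * b * ((sqnorm (grad f y) + sqnorm q - sqnorm (grad f y - q)) / 2).
  by rewrite -dotv_polar /v -scaleNr dotvDr !dotvZr mulNr.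
have : sqnorm v <= 2 * (b ^+ 2 * sqnorm e) + 2 * ((al * b) ^+ 2 * sqnorm q).
  by rewrite /v -scaleNr; apply: le_trans (sqnormD_le _ _) _; rewrite !sqnormZ sqrrN.
move=> /(ler_wpM2l (addr_ge0 H0 ler01)).
have := ler_wpM2l ab0 hD; lra.
Qed.

Lemma grad_lincomb (I : finType) (Q : pred I) (a : R) (c : I -> R)
    (F : I -> 'rV[R]_n -> R) y :
  (forall i, differentiable (F i) y) ->
  grad (fun x => a * \sum_(i | Q i) c i * F i x) y =
    a *: \sum_(i | Q i) c i *: grad (F i) y.
Proof.
move=> dF; apply/rowP => k; rewrite !mxE summxE.
suff : is_derive y (delta_mx 0 k) (fun x => a * \sum_(i | Q i) c i * F i x)
   (a *: \sum_(i | Q i) c i *: 'D_(delta_mx 0 k) (F i) y).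
  move=> h; rewrite (@derive_val _ _ _ _ _ _ _ h).
  by congr (_ * _); apply: eq_bigr => i _; rewrite !mxE.
apply: is_deriveZ.
have : is_derive y (delta_mx 0 k) (\sum_(i | Q i) (c i *: F i))
   (\sum_(i | Q i) c i *: 'D_(delta_mx 0 k) (F i) y).
  elim/big_ind2 : _ => [|f df g dg hf hg|i _].
  - exact: is_derive_cst.
  - exact: is_deriveD.
  - by apply: is_deriveZ; apply/derivableP/diff_derivable.
by congr is_derive; apply/funext => x; rewrite fct_sumE.
Qed.

Lemma differentiable_lincomb (I : finType) (Q : pred I) (a : R) (c : I -> R)
    (F : I -> 'rV[R]_n -> R) y :
  (forall i, differentiable (F i) y) ->
  differentiable (fun x => a * \sum_(i | Q i) c i * F i x) y.
Proof.
move=> dF; apply: (@differentiableZ _ _ _ (fun x => \sum_(i | Q i) c i * F i x)).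
have -> : (fun x => \sum_(i | Q i) c i * F i x) = \sum_(i | Q i) (c i *: F i).
  by apply/funext => x; rewrite fct_sumE.
elim/big_ind : _ => [|f g hf hg|i _].
- exact: differentiable_cst.
- exact: differentiableD.
- exact: differentiableZ.
Qed.

End gradient.

(** * Mixing and dispersion of the agents *)

Section consensus.
Context (R : realType) (n : nat) (r : 'I_n -> R).
Hypotheses (r_gt0 : forall i, 0 < r i) (r_sum1 : \sum_i r i = 1).
Implicit Types (a b x z : 'I_n -> R) (W : 'M[R]_n).

Definition wsq a : R := \sum_i r i * a i ^+ 2.
Definition wavg a : R := \sum_i r i * a i.
(** Twice the Dirichlet form of the Markov chain [W], for which the weights [r]
    are stationary when [mixing W] holds. *)
Definition disagreement W a : R :=
  \sum_i r i * \sum_j W i j * (a j - a i) ^+ 2.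

Definition mixing W : Prop :=
  [/\ forall i j, 0 <= W i j, forall i, \sum_j W i j = 1
    & forall j, \sum_i r i * W i j = r j].

Let eq_ler (c c' : R) : c = c' -> c <= c'. Proof. by move=> ->. Qed.

Let r_ge0 i : 0 <= r i. Proof. exact: ltW. Qed.

Lemma wsq_ge0 a : 0 <= wsq a.
Proof. by apply: sumr_ge0 => i _; rewrite mulr_ge0 ?sqr_ge0. Qed.

Lemma wsq_center_min a c :
  wsq (fun i => a i - wavg a) <= wsq (fun i => a i - c).
Proof. exact: wmean_variance_min. Qed.

Lemma disagreement_ge0 W a : mixing W -> 0 <= disagreement W a.
Proof.
move=> [W0 _ _]; apply: sumr_ge0 => i _; rewrite mulr_ge0//.
by apply: sumr_ge0 => j _; rewrite mulr_ge0 ?sqr_ge0.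
Qed.

Lemma wsq_mix W a : mixing W -> \sum_i r i * \sum_j W i j * a j ^+ 2 = wsq a.
Proof.
move=> [_ _ rW]; under eq_bigr do rewrite mulr_sumr.
rewrite exchange_big/=; apply: eq_bigr => j _.
by rewrite -[in RHS]rW mulr_suml; apply: eq_bigr => i _; rewrite mulrA.
Qed.

Lemma wsqD_le a b : wsq (fun i => a i + b i) <= 2 * wsq a + 2 * wsq b.
Proof.
rewrite /wsq !mulr_sumr -big_split; apply: ler_sum => i _ /=.
by have := mulr_ge0 (r_ge0 i) (sqr_ge0 (a i - b i)); nra.
Qed.

Lemma wsqD_young a b (th : R) : 0 < th ->
  wsq (fun i => a i + b i) <= (1 + th) * wsq a + (1 + th^-1) * wsq b.
Proof.
move=> th0; rewrite /wsq !mulr_sumr -big_split; apply: ler_sum => i _ /=.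
have -> : (1 + th) * (r i * a i ^+ 2) + (1 + th^-1) * (r i * b i ^+ 2) =
   r i * (a i + b i) ^+ 2 + r i * (th * (a i - th^-1 * b i) ^+ 2).
  by field; rewrite gt_eqF.
by rewrite lerDl mulr_ge0// mulr_ge0 ?sqr_ge0 ?ltW.
Qed.

Lemma disagreement_le_wsq W a c :
  mixing W -> disagreement W a <= 4 * wsq (fun i => a i - c).
Proof.
move=> mW; have [W0 W1 rW] := mW.
have -> : 4 * wsq (fun i => a i - c) = \sum_i r i * (\sum_j W i j *
    (2 * (a j - c) ^+ 2) + 2 * (a i - c) ^+ 2).
  under [RHS]eq_bigr => i _.
    under eq_bigr do rewrite mulrCA.
    rewrite -mulr_sumr mulrDr mulrCA (mulrCA (r i)); over.
  by rewrite big_split /= -!mulr_sumr (wsq_mix (fun j => a j - c))// /wsq; ring.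
apply: ler_sum => i _; rewrite ler_wpM2l//.
rewrite [X in _ <= _ + X](_ : _ = \sum_j W i j * (2 * (a i - c) ^+ 2)); last first.
  by rewrite -mulr_suml W1 mul1r.
rewrite -big_split /=.
apply: ler_sum => j _; rewrite -mulrDr ler_wpM2l//.
by have := sqr_ge0 ((a j - c) + (a i - c)); nra.
Qed.

Lemma wsq_drift_le W a :
  mixing W -> wsq (fun i => \sum_j W i j * a j - a i) <= disagreement W a.
Proof.
move=> [W0 W1 rW]; apply: ler_sum => i _; rewrite ler_wpM2l//.
have -> : \sum_j W i j * a j - a i = \sum_j W i j * (a j - a i).
  by under [RHS]eq_bigr do rewrite mulrBr; rewrite sumrB -mulr_suml W1 mul1r.
exact: sqr_wmean_le.
Qed.

(** Each new value is a convex combination of old ones, so that the weighted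
    square sum cannot grow ([r] is stationary for [W]); what Jensen's
    inequality gives away is the spread of the values that are averaged, and
    the part of it between an agent and its neighbours is kept. *)
Lemma wsq_mix_le W a (b : R) : mixing W ->
  wsq (fun i => (1 - b) * a i + b * \sum_j W i j * a j) <=
    wsq a - b * (1 - b) * disagreement W a.
Proof.
move=> mW; have [W0 W1 rW] := mW.
have -> : wsq a - b * (1 - b) * disagreement W a =
  \sum_i r i * ((1 - b) * a i ^+ 2 + b * (\sum_j W i j * a j ^+ 2)
     - b * (1 - b) * \sum_j W i j * (a j - a i) ^+ 2).
  transitivity ((1 - b) * wsq a + b * \sum_i r i * (\sum_j W i j * a j ^+ 2)
     - b * (1 - b) * disagreement W a); first by rewrite wsq_mix//; ring.
  rewrite /wsq /disagreement !mulr_sumr -big_split -sumrB /=.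
  by apply: eq_bigr => i _; ring.
apply: ler_sum => i _; rewrite ler_wpM2l//.
have bv c := wmean_bias_variance (W1 i) a c.
have := bv (a i); have := bv 0.
under eq_bigr do rewrite subr0.
rewrite subr0 => -> ->.
set m := \sum_j W i j * a j.
have v0 : 0 <= \sum_j W i j * (a j - m) ^+ 2.
  by apply: sumr_ge0 => j _; rewrite mulr_ge0 ?sqr_ge0.
by have := mulr_ge0 (sqr_ge0 b) v0; nra.
Qed.

(** The new average minimizes the spread, so that it may be replaced by
    [wavg x - al * b * c].  The deviation from this point is [m i + b * e i], in
    which the common part [c] of the gradients has disappeared and the noise is
    kept apart from what is known before it is drawn. *)
Lemma dispersion_step W x x' e g m (al b c th : R) : mixing W -> 0 < th ->
  (forall i, x' i = (1 - b) * x i + b * (\sum_j W i j * x j + e i)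
                    - al * b * g i) ->
  (forall i, m i = (1 - b) * (x i - wavg x)
                   + b * (\sum_j W i j * (x j - wavg x))
                   - al * b * (g i - c)) ->
  wsq (fun i => x' i - wavg x') <=
    (1 + th) * (wsq (fun i => x i - wavg x) - b * (1 - b) * disagreement W x)
    + (1 + th^-1) * (al ^+ 2 * b ^+ 2 * wsq (fun i => g i - c))
    + 2 * b * (\sum_i r i * (m i * e i)) + b ^+ 2 * wsq e.
Proof.
move=> mW th0 x'E mE; have [W0 W1 rW] := mW.
apply: le_trans (wsq_center_min x' (wavg x - al * b * c)) _.
have -> : wsq (fun i => x' i - (wavg x - al * b * c)) =
    wsq m + 2 * b * (\sum_i r i * (m i * e i)) + b ^+ 2 * wsq e.
  rewrite /wsq !mulr_sumr -!big_split; apply: eq_bigr => i _ /=.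
  have -> : x' i - (wavg x - al * b * c) = m i + b * e i.
    rewrite x'E mE.
    under [\sum_j W i j * (x j - _)]eq_bigr do rewrite mulrBr.
    by rewrite sumrB -mulr_suml W1; ring.
  by ring.
pose a i := x i - wavg x.
rewrite !lerD2r.
have -> : wsq m = wsq (fun i => ((1 - b) * a i + b * (\sum_j W i j * a j))
    + - (al * b) * (g i - c)).
  by apply: eq_bigr => i _; rewrite mE /a; ring.
apply: le_trans (wsqD_young _ _ th0) _; apply: lerD.
  rewrite ler_wpM2l ?addr_ge0 ?(ltW th0)//; apply: le_trans (wsq_mix_le _ _ mW) _.
  rewrite lerD2l lerN2; apply: eq_ler; congr (_ * _).
  apply: eq_bigr => i _; congr (_ * _); apply: eq_bigr => j _.
  by rewrite /a; congr (_ * _); ring.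
rewrite ler_wpM2l ?addr_ge0 ?invr_ge0 ?(ltW th0)// /wsq mulr_sumr.
by apply/eq_ler/eq_bigr => i _; ring.
Qed.

Lemma step_size_le W x x' e g (al b c : R) : mixing W ->
  (forall i, x' i = (1 - b) * x i + b * (\sum_j W i j * x j + e i)
                    - al * b * g i) ->
  wsq (fun i => x' i - x i + al * b * c) <=
    4 * b ^+ 2 * (disagreement W x + wsq e + al ^+ 2 * wsq (fun i => g i - c)).
Proof.
move=> mW x'E.
have -> : wsq (fun i => x' i - x i + al * b * c) = b ^+ 2 *
  wsq (fun i => (\sum_j W i j * x j - x i) + (e i + - al * (g i - c))).
  by rewrite /wsq mulr_sumr; apply: eq_bigr => i _; rewrite x'E; ring.
rewrite (mulrC 4) -[leRHS]mulrA ler_wpM2l ?sqr_ge0//.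
apply: le_trans (wsqD_le _ _) _.
have := wsq_drift_le x mW.
have : wsq (fun i => e i + - al * (g i - c)) <=
    2 * wsq e + 2 * (al ^+ 2 * wsq (fun i => g i - c)).
  apply: le_trans (wsqD_le _ _) _; rewrite lerD2l ler_wpM2l// /wsq mulr_sumr.
  by apply/eq_ler/eq_bigr => i _; ring.
by have := disagreement_ge0 x mW; lra.
Qed.

(** Disagreement depends on differences of values only, so a common shift
    of all the agents is harmless. *)
Lemma disagreement_perturb W x y (c : R) : mixing W ->
  disagreement W y <=
    2 * disagreement W x + 8 * wsq (fun i => y i - x i - c).
Proof.
move=> mW; have [W0 W1 rW] := mW.
have h : disagreement W y <=
    2 * disagreement W x + 2 * disagreement W (fun i => y i - x i).
  rewrite /disagreement !mulr_sumr -big_split; apply: ler_sum => i _ /=.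
  rewrite !(mulrCA 2) -mulrDr ler_wpM2l// !mulr_sumr -big_split.
  apply: ler_sum => j _ /=; rewrite !(mulrCA 2) -mulrDr ler_wpM2l//.
  by have := sqr_ge0 ((x j - x i) - (y j - x j - (y i - x i))); nra.
apply: (le_trans h); have := disagreement_le_wsq (fun i => y i - x i) c mW; lra.
Qed.

(** As the weights sum to one, their product is a positive lower bound for each of
    them. *)
Let rmin : R := \prod_i r i.

Let rmin_gt0 : 0 < rmin. Proof. exact: prodr_gt0. Qed.

Let rmin_le i : rmin <= r i.
Proof.
have r1 j : r j <= 1.
  by rewrite -r_sum1 (bigD1 j)//= lerDl sumr_ge0.
rewrite /rmin (bigD1 i)//= ler_piMr//.
by apply: prodr_ile1 => j _; rewrite r_ge0 r1.
Qed.

Lemma path_dist_le (T : Type) (e : rel T) (x : T -> R) (M : R) :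
  (forall i j, e i j -> `|x i - x j| <= M) ->
  forall p i, path e i p -> `|x i - x (last i p)| <= (size p)%:R * M.
Proof.
move=> eM; elim=> [|j p IH] i /=; first by rewrite subrr normr0 mul0r.
move=> /andP[ij jp]; apply: le_trans (ler_distD (x j) _ _) _.
by rewrite -natr1 mulrDl mul1r addrC; apply: lerD; [exact: IH|exact: eM].
Qed.

Definition poincare_const (eta : R) : R := rmin * eta / n%:R ^+ 2.

Lemma poincare_const_gt0 eta : 0 < eta -> 0 < poincare_const eta.
Proof.
move=> eta0; have n0 : (0 < n)%N.
  case: (posnP n) r_sum1 => // n0; rewrite big1 => [/eqP|i _].
    by rewrite eq_sym oner_eq0.
  by have := leq_ltn_trans (leq0n i) (ltn_ord i); rewrite n0.
by rewrite divr_gt0 ?mulr_gt0 ?exprn_gt0 ?ltr0n.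
Qed.

(** A Poincare inequality on a strongly connected window: two agents are joined
    by a path of at most [n] edges, and the difference along an edge is
    controlled by the disagreement at the time at which the edge is present. *)
Lemma dispersion_le_window (W : nat -> 'M[R]_n) (B t : nat) (eta : R) x :
  (forall k, (t < k)%N -> mixing (W k)) -> 0 < eta ->
  (forall k i j, (t < k)%N -> 0 < W k i j -> eta <= W k i j) ->
  (forall i j, connect (window_edge W B t) i j) ->
  poincare_const eta * wsq (fun i => x i - wavg x) <=
    \sum_(t.+1 <= k < (t + B).+1) disagreement (W k) x.
Proof.
move=> mW eta0 Weta conn.
set S := \sum_(_ <= _ < _) _.
have S0 : 0 <= S.
  rewrite /S big_seq; apply: sumr_ge0 => k; rewrite mem_index_iota => /andP[tk _].
  exact/disagreement_ge0/mW.
have re0 : 0 < rmin * eta by rewrite mulr_gt0.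
pose M := Num.sqrt (S / (rmin * eta)).
have edgeM i j : window_edge W B t i j -> `|x i - x j| <= M.
  move=> /hasP[k kin Wji]; have := kin; rewrite mem_index_iota => /andP[tk _].
  rewrite -sqrtr_sqr ler_sqrt ?divr_ge0 ?(ltW re0)// ler_pdivlMr//.
  have -> : S = disagreement (W k) x +
      \sum_(k' <- rem k (index_iota t.+1 (t + B).+1)) disagreement (W k') x.
    by rewrite /S (big_rem k).
  have [W0 _ _] := mW k tk.
  apply: (@le_trans _ _ (disagreement (W k) x)); last first.
    rewrite lerDl big_seq; apply: sumr_ge0 => k' /mem_rem.
    by rewrite mem_index_iota => /andP[tk' _]; exact/disagreement_ge0/mW.
  rewrite /disagreement (bigD1 j)//= (bigD1 i)//=.
  apply: (@le_trans _ _ (r j * (W k j i * (x i - x j) ^+ 2))).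
    rewrite mulrC -mulrA; apply: ler_pM => //; first exact: ltW.
      by rewrite mulr_ge0 ?sqr_ge0// ltW.
    by rewrite ler_wpM2r ?sqr_ge0// Weta.
  rewrite mulrDr -addrA lerDl addr_ge0//.
    by rewrite mulr_ge0// sumr_ge0// => i' _; rewrite mulr_ge0 ?sqr_ge0.
  apply: sumr_ge0 => j' _; rewrite mulr_ge0// sumr_ge0// => i' _.
  by rewrite mulr_ge0 ?sqr_ge0.
have distM i j : `|x i - x j| <= n%:R * M.
  have /connectP[p ep ->] := conn i j.
  have [p' ep' up' _] := shortenP ep.
  apply: le_trans (path_dist_le edgeM ep') _.
  rewrite ler_wpM2r ?sqrtr_ge0// ler_nat ltnW//.
  by have := max_card (mem (i :: p')); rewrite card_ord (card_uniqP up').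
have sqM i j : (x i - x j) ^+ 2 <= n%:R ^+ 2 * (S / (rmin * eta)).
  rewrite -real_normK ?num_real// -[X in _ * X]sqr_sqrtr ?divr_ge0 ?(ltW re0)//.
  by rewrite -exprMn lerXn2r ?nnegrE ?mulr_ge0 ?sqrtr_ge0.
have pc0 := poincare_const_gt0 eta0.
have [i0|noi] := pselect (exists i : 'I_n, True); last first.
  have -> : wsq (fun i => x i - wavg x) = 0.
    by apply: big1 => i; case: noi; exists i.
  by rewrite mulr0.
case: i0 => i0 _.
rewrite mulrC -ler_pdivlMr//.
apply: le_trans (wsq_center_min x (x i0)) _.
have -> : S / poincare_const eta =
    \sum_i r i * (n%:R ^+ 2 * (S / (rmin * eta))).
  rewrite -mulr_suml r_sum1 /poincare_const.
  have nn : n%:R != 0 :> R by rewrite pnatr_eq0; case: (n) i0 => // -[].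
  by field; rewrite nn !gt_eqF.
by apply: ler_sum => i _; rewrite ler_wpM2l.
Qed.

Lemma wavg_mix W a : mixing W -> wavg (fun i => \sum_j W i j * a j) = wavg a.
Proof.
move=> [_ _ rW]; rewrite /wavg; under eq_bigr do rewrite mulr_sumr.
rewrite exchange_big/=; apply: eq_bigr => j _.
by rewrite -[in RHS]rW mulr_suml; apply: eq_bigr => i _; rewrite mulrA.
Qed.

Lemma wsq_sum_le (s : seq nat) (z : nat -> 'I_n -> R) :
  wsq (fun i => \sum_(u <- s) z u i) <= (size s)%:R * \sum_(u <- s) wsq (z u).
Proof.
have sqr_sum (a : nat -> R) (q : seq nat) :
    (\sum_(u <- q) a u) ^+ 2 <= (size q)%:R * \sum_(u <- q) a u ^+ 2.
  elim: q => [|u q IH]; first by rewrite !big_nil expr0n mulr0.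
  rewrite !big_cons /= -natr1; case: q IH => [|v q] IH.
    by rewrite !big_nil /= !addr0 add0r mul1r.
  move: IH; set m := (size _)%:R; set S := \sum_(_ <- _) _; set V := \sum_(_ <- _) _.
  move=> IH; have m0 : 0 < m by rewrite ltr0n.
  have : 2 * a u * S <= m * a u ^+ 2 + V.
    rewrite -(ler_pM2l m0); have := sqr_ge0 (m * a u - S); nra.
  by nra.
rewrite mulr_sumr /wsq; under [leRHS]eq_bigr do rewrite mulr_sumr.
rewrite exchange_big/=; apply: ler_sum => i _.
under [leRHS]eq_bigr do rewrite mulrCA.
by rewrite -mulr_sumr -mulr_sumr ler_wpM2l// sqr_sum.
Qed.

(** The window lies just before [t]: along it the agents move only by the step
    sizes, which makes the disagreements observed on the way comparable with the
    disagreement that the same links would see at time [t]. *)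
Lemma dispersion_window_le (W : nat -> 'M[R]_n) (x e g : nat -> 'I_n -> R)
    (al b c : nat -> R) (B t : nat) (eta : R) :
  (forall k, (1 <= k)%N -> mixing (W k)) -> 0 < eta ->
  (forall k i j, (1 <= k)%N -> 0 < W k i j -> eta <= W k i j) ->
  (forall t, (1 <= t)%N -> forall i j, connect (window_edge W B t) i j) ->
  (forall s, (1 <= s)%N -> forall i, x s.+1 i = (1 - b s) * x s i
     + b s * (\sum_j W s i j * x s j + e s i) - al s * b s * g s i) ->
  (B.+2 <= t)%N ->
  poincare_const eta * wsq (fun i => x t i - wavg (x t)) <=
    \sum_(t - B <= s < t)
      (2 * disagreement (W s) (x s) + 32 * B%:R ^+ 2 * (b s ^+ 2 *
        (disagreement (W s) (x s) + wsq (e s)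
         + al s ^+ 2 * wsq (fun i => g s i - c s)))).
Proof.
move=> mW eta0 Weta conn xE Bt.
have [t' tE] : exists t', t = (t'.+1 + B)%N /\ (1 <= t')%N.
  by exists (t - B.+1)%N; lia.
case: tE => tE t'1.
have -> : index_iota (t - B) t = index_iota t'.+1 (t' + B).+1.
  by congr index_iota; lia.
apply: le_trans (dispersion_le_window (x t) _ eta0 _ (conn _ t'1)) _.
- by move=> k tk; apply: mW; exact: leq_trans tk.
- by move=> k i j tk; apply: Weta; exact: leq_trans tk.
(* moves, recentred by the common drift of the agents *)
pose z u i := x u.+1 i - x u i + al u * b u * c u.
pose Z := \sum_(t'.+1 <= u < (t' + B).+1) wsq (z u).
have zle u : (1 <= u)%N -> wsq (z u) <= 4 * b u ^+ 2 *
    (disagreement (W u) (x u) + wsq (e u) + al u ^+ 2 * wsq (fun i => g u i - c u)).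
  by move=> u1; apply: step_size_le (mW _ u1) (xE _ u1).
have one s : (t'.+1 <= s < (t' + B).+1)%N ->
    disagreement (W s) (x t) <= 2 * disagreement (W s) (x s) + 8 * B%:R * Z.
  move=> /andP[ts st]; have s1 : (1 <= s)%N by exact: leq_trans ts.
  apply: le_trans (disagreement_perturb (x s) (x t)
    (- \sum_(s <= u < t) al u * b u * c u) (mW _ s1)) _.
  rewrite lerD2l -mulrA ler_wpM2l//.
  have -> : wsq (fun i => x t i - x s i - - \sum_(s <= u < t) al u * b u * c u) =
      wsq (fun i => \sum_(u <- index_iota s t) z u i).
    apply: eq_bigr => i _; rewrite big_split /= opprK.
    by rewrite (@telescope_sumr _ s t (fun u => x u i))//; lia.
  apply: le_trans (wsq_sum_le _ _) _; rewrite size_iota.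
  apply: ler_pM => //.
  - by apply: sumr_ge0 => u _; exact: wsq_ge0.
  - by rewrite ler_nat; lia.
  rewrite /Z (@big_cat_nat _ _ _ s t'.+1)//=; last by lia.
  rewrite tE addSn lerDr; apply: sumr_ge0 => u _; exact: wsq_ge0.
rewrite big_split /= -mulr_sumr.
apply: (@le_trans _ _ (\sum_(t'.+1 <= s < (t' + B).+1)
    (2 * disagreement (W s) (x s) + 8 * B%:R * Z))).
  by rewrite [leLHS]big_nat_cond [leRHS]big_nat_cond; apply: ler_sum => s /andP[/one].
rewrite big_split /= -mulr_sumr lerD2l sumr_const_nat.
have -> : ((t' + B).+1 - t'.+1 = B)%N by lia.
rewrite -mulr_natl -!mulr_sumr.
apply: (@le_trans _ _ (8 * B%:R ^+ 2 * Z)).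
  by rewrite le_eqVlt; apply/orP; left; apply/eqP; ring.
have -> : 32 * B%:R ^+ 2 = 8 * B%:R ^+ 2 * 4 :> R by ring.
rewrite -[leRHS]mulrA ler_wpM2l ?mulr_ge0 ?exprn_ge0// mulr_sumr.
rewrite /Z [leLHS]big_nat_cond [leRHS]big_nat_cond.
apply: ler_sum => u /andP[/andP[tu _] _]; rewrite mulrA.
by apply: zle; exact: leq_trans tu.
Qed.

End consensus.

(** * Summing the dispersion recursion *)

Section partial_sums.
Context (R : realType).
Implicit Types (a f : nat -> R) (T : nat).

Definition psum a T : R := \sum_(1 <= t < T.+1) a t.

Lemma psum0 a : psum a 0 = 0. Proof. by rewrite /psum big_geq. Qed.

Lemma psumS a T : psum a T.+1 = psum a T + a T.+1.
Proof. by rewrite /psum big_nat_recr. Qed.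

Lemma psumD a f T : psum (fun t => a t + f t) T = psum a T + psum f T.
Proof. exact: big_split. Qed.

Lemma psumZ (c : R) a T : psum (fun t => c * a t) T = c * psum a T.
Proof. by rewrite /psum mulr_sumr. Qed.

Lemma psum_ge0 a T : (forall t, (1 <= t)%N -> 0 <= a t) -> 0 <= psum a T.
Proof.
move=> a0; elim: T => [|T IH]; first by rewrite psum0.
by rewrite psumS addr_ge0 ?a0.
Qed.

Lemma psum_le a f T : (forall t, (1 <= t)%N -> a t <= f t) -> psum a T <= psum f T.
Proof.
move=> af; elim: T => [|T IH]; first by rewrite !psum0.
by rewrite !psumS lerD ?af.
Qed.

Lemma psum_mono a T T' : (forall t, (1 <= t)%N -> 0 <= a t) -> (T <= T')%N ->
  psum a T <= psum a T'.
Proof.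
move=> a0 /subnK <-; elim: (T' - T)%N => [//|k IH].
by rewrite addSn psumS (le_trans IH)// lerDl a0.
Qed.

Lemma psum_telescope_le (D v a : nat -> R) T :
  (forall t, (1 <= t)%N -> D t <= 2 * (v t - v t.+1) + a t) ->
  psum D T + 2 * v T.+1 <= 2 * v 1%N + psum a T.
Proof.
move=> Dle; elim: T => [|T IH]; first by rewrite !psum0 addr0 add0r.
by rewrite !psumS; have := Dle T.+1 isT; lra.
Qed.

(** For terms that are controlled beyond [t0] only: the earlier ones go into a
    constant. *)
Lemma psum_split_le a f t0 T : (forall t, (1 <= t)%N -> 0 <= a t) ->
  (forall t, (1 <= t)%N -> 0 <= f t) ->
  (forall t, (t0 < t)%N -> a t <= f t) ->
  psum a T <= psum a t0 + psum f T.
Proof.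
move=> a0 f0 af; have [Tt|tT] := leqP T t0.
  by rewrite (le_trans (psum_mono a0 Tt))// lerDl psum_ge0.
rewrite -(subnK (ltnW tT)).
elim: (T - t0)%N => [|k IH]; first by rewrite lerDl psum_ge0.
by rewrite addSn !psumS addrA lerD// af// ltnS leq_addl.
Qed.

(** In the double sum an index [s] occurs once for each of the [B] windows
    that contain it. *)
Lemma psum_windows_le a B T : (forall t, (1 <= t)%N -> 0 <= a t) ->
  \sum_(B.+2 <= t < T.+1) \sum_(t - B <= s < t) a s <= B%:R * psum a T.
Proof.
move=> a0.
have -> : \sum_(B.+2 <= t < T.+1) \sum_(t - B <= s < t) a s =
    \sum_(j < B) \sum_(B.+2 <= t < T.+1) a (j + (t - B))%N.
  rewrite exchange_big/= [LHS]big_nat_cond [RHS]big_nat_cond.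
  apply: eq_bigr => t /andP[/andP[Bt _] _].
  by rewrite -{1}[(t - B)%N]add0n big_addn subKn ?big_mkord// ltnW// ltnW.
have -> : B%:R * psum a T = \sum_(j < B) psum a T.
  by rewrite sumr_const card_ord mulr_natl.
apply: ler_sum => j _.
have -> : \sum_(B.+2 <= t < T.+1) a (j + (t - B))%N =
    \sum_(0 <= i < T.+1 - B.+2) a (i + j.+2)%N.
  rewrite -{1}[B.+2]add0n big_addn; apply: eq_bigr => i _.
  by congr a; have := ltn_ord j; lia.
have -> : \sum_(0 <= i < T.+1 - B.+2) a (i + j.+2)%N =
    \sum_(j.+2 <= i < (T.+1 - B.+2) + j.+2) a i.
  by rewrite -{2}[j.+2]add0n big_addn addnK.
have jB := ltn_ord j.
have [TB|BT] := leqP T B.+1.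
  by rewrite big_geq ?psum_ge0//; lia.
rewrite /psum (@big_cat_nat _ _ _ j.+2 1%N T.+1)//=; last by lia.
rewrite (@big_cat_nat _ _ _ (T.+1 - B.+2 + j.+2)%N j.+2 T.+1)//=; try lia.
rewrite addrCA lerDl addr_ge0//.
  rewrite big_nat_cond; apply: sumr_ge0 => i /andP[/andP[i1 _] _]; exact: a0.
rewrite big_nat_cond; apply: sumr_ge0 => i /andP[/andP[i1 _] _]; apply: a0.
by lia.
Qed.

End partial_sums.

(** [U], [Q] and [G] stand for the mean squares of the dispersion, of the
    disagreement along the links, and of the deviation of the gradients. *)
Section summed_dispersion.
Context (R : realType).
Variables (U Q G alpha beta : nat -> R) (B : nat)
  (b0 kap C1 G1 G2 gam Cb : R).
Hypotheses (kap0 : 0 < kap) (C10 : 0 <= C1) (G10 : 0 <= G1) (G20 : 0 <= G2)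
  (gam0 : 0 <= gam) (Cb0 : 0 <= Cb) (b01 : b0 < 1).
Hypotheses (al0 : forall t, (1 <= t)%N -> 0 < alpha t)
  (al_dec : forall t, (1 <= t)%N -> alpha t.+1 <= alpha t)
  (be0 : forall t, (1 <= t)%N -> 0 < beta t)
  (beb0 : forall t, (1 <= t)%N -> beta t <= b0)
  (ab_dec : forall s t, (1 <= s)%N -> (s <= t)%N ->
    alpha t * beta t <= alpha s * beta s)
  (be_al : forall t, (1 <= t)%N -> beta t <= Cb * alpha t ^+ 2)
  (al_small : forall de : R, 0 < de ->
    exists t0, forall t, (t0 < t)%N -> alpha t ^+ 2 <= de).
Hypotheses (U0 : forall t, (1 <= t)%N -> 0 <= U t)
  (Q0 : forall t, (1 <= t)%N -> 0 <= Q t)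
  (GU : forall t, (1 <= t)%N -> G t <= G1 + G2 * U t)
  (G0 : forall t, (1 <= t)%N -> 0 <= G t).
Hypothesis U_step : forall t (th : R), (1 <= t)%N -> 0 < th ->
  U t.+1 <= (1 + th) * (U t - beta t * (1 - beta t) * Q t)
    + (1 + th^-1) * (alpha t ^+ 2 * beta t ^+ 2 * G t) + beta t ^+ 2 * gam.
Hypothesis U_window : forall t, (B.+2 <= t)%N ->
  kap * U t <= \sum_(t - B <= s < t)
    C1 * (Q s + beta s ^+ 2 * (gam + alpha s ^+ 2 * G s)).

Let abU t := alpha t * beta t * U t.
Let abQ t := alpha t * beta t * Q t.
Let lam t := alpha t ^+ 3 * beta t.
Let a3bU t := lam t * U t.

Let be1 t : (1 <= t)%N -> beta t <= 1.
Proof. by move=> t1; rewrite (le_trans (beb0 t1))// ltW. Qed.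

Let abU_ge0 t : (1 <= t)%N -> 0 <= abU t.
Proof. by move=> t1; rewrite mulr_ge0 ?U0// mulr_ge0 ?ltW ?al0 ?be0. Qed.

Let lam_ge0 t : (1 <= t)%N -> 0 <= lam t.
Proof. by move=> t1; rewrite mulr_ge0 ?exprn_ge0 ?ltW ?al0 ?be0. Qed.

(** The one-step recursion, with the Young parameter [c * beta t] and
    the nonincreasing weight [alpha t], telescopes. *)
Let sum_Q_le (c : R) T : 0 < c ->
  (1 - b0) * psum abQ T <= alpha 1%N * U 1%N + c * psum abU T
    + (1 + c^-1) * (G1 * psum lam T + G2 * psum a3bU T)
    + Cb * gam * psum lam T.
Proof.
move=> c0.
suff : alpha T.+1 * U T.+1 + (1 - b0) * psum abQ T <=
    alpha 1%N * U 1%N + c * psum abU T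
    + (1 + c^-1) * (G1 * psum lam T + G2 * psum a3bU T)
    + Cb * gam * psum lam T.
  apply: le_trans; rewrite lerDr mulr_ge0 ?U0// ltW// al0//.
elim: T => [|T IH]; first by rewrite !psum0 !mulr0 !addr0 mulr0 addr0.
rewrite !psumS; set t := T.+1 in IH *.
suff : alpha t.+1 * U t.+1 + (1 - b0) * abQ t <= alpha t * U t + c * abU t
    + (1 + c^-1) * (G1 * lam t + G2 * a3bU t) + Cb * gam * lam t by lra.
have t1 : (1 <= t)%N by [].
have a0 := al0 t1; have b_0 := be0 t1; have b_1 := be1 t1.
have ci0 : 0 < c^-1 by rewrite invr_gt0.
have cb0 : 0 < c * beta t by rewrite mulr_gt0.
have step := U_step t1 cb0.
have h1 : (1 + c * beta t) * (U t - beta t * (1 - beta t) * Q t) <=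
    U t + c * beta t * U t - (1 - b0) * beta t * Q t.
  have bQ : 0 <= beta t * Q t by rewrite mulr_ge0 ?Q0// ltW.
  have : (1 - b0) * (beta t * Q t) <= (1 + c * beta t) * (1 - beta t) * (beta t * Q t).
    rewrite ler_wpM2r// -[leLHS]mul1r; apply: ler_pM => //; last 1 first.
    - by have := beb0 t1; lra.
    - by rewrite subr_ge0 ltW.
    - by rewrite lerDl ltW.
  lra.
have h2 : (1 + (c * beta t)^-1) * (alpha t ^+ 2 * beta t ^+ 2 * G t) <=
    (1 + c^-1) * (alpha t ^+ 2 * beta t * (G1 + G2 * U t)).
  have -> : (1 + (c * beta t)^-1) * (alpha t ^+ 2 * beta t ^+ 2 * G t) =
      (beta t + c^-1) * (alpha t ^+ 2 * beta t * G t).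
    by field; rewrite !gt_eqF.
  apply: ler_pM.
  - by rewrite addr_ge0 ?ltW.
  - by rewrite mulr_ge0 ?G0// mulr_ge0 ?exprn_ge0 ?ltW.
  - by rewrite lerD2r.
  - by rewrite ler_wpM2l ?GU// mulr_ge0 ?exprn_ge0 ?ltW.
have h3 : beta t ^+ 2 * gam <= beta t * (Cb * alpha t ^+ 2) * gam.
  by rewrite ler_wpM2r// expr2 ler_wpM2l ?(ltW b_0)// be_al.
have h4 : U t.+1 + (1 - b0) * beta t * Q t <= U t + c * beta t * U t
    + (1 + c^-1) * (alpha t ^+ 2 * beta t * (G1 + G2 * U t))
    + beta t * (Cb * alpha t ^+ 2) * gam by lra.
have h5 : alpha t.+1 * U t.+1 <= alpha t * U t.+1.
  by rewrite ler_wpM2r ?U0// al_dec.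
have := ler_wpM2l (ltW a0) h4.
rewrite /abQ /abU /a3bU /lam; lra.
Qed.

(** The window lies before [t] and the weights [alpha t * beta t] decrease, so that
    each term of the window may be given the weight of its own index. *)
Let sum_U_le T :
  kap * psum abU T <= kap * psum abU B.+1 +
    C1 * (B%:R * (psum abQ T + (Cb * gam + G1) * psum lam T
                  + G2 * psum a3bU T)).
Proof.
pose a t := C1 * (abQ t + (Cb * gam + G1) * lam t + G2 * a3bU t).
have a_ge0 t : (1 <= t)%N -> 0 <= a t.
  move=> t1; rewrite mulr_ge0// !addr_ge0//.
  - by rewrite mulr_ge0 ?Q0// mulr_ge0 ?ltW ?al0 ?be0.
  - by rewrite mulr_ge0 ?lam_ge0// addr_ge0// mulr_ge0.
  - by rewrite mulr_ge0// mulr_ge0 ?lam_ge0 ?U0.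
have E : C1 * (B%:R * (psum abQ T + (Cb * gam + G1) * psum lam T
    + G2 * psum a3bU T)) = B%:R * psum a T.
  by rewrite /a psumZ !psumD !psumZ; ring.
rewrite E; apply: le_trans (_ : kap * psum abU B.+1 +
   \sum_(B.+2 <= t < T.+1) \sum_(t - B <= s < t) a s <= _); last first.
  by rewrite lerD2l psum_windows_le.
have [TB|BT] := leqP T B.+1.
  rewrite [X in _ + X]big_geq// addr0 ler_wpM2l ?(ltW kap0)// psum_mono//.
rewrite {1}/psum (@big_cat_nat _ _ _ B.+2 1%N T.+1)//=; last exact: ltnW.
rewrite mulrDr lerD2l mulr_sumr.
rewrite [leLHS]big_nat_cond [leRHS]big_nat_cond; apply: ler_sum.
move=> t /andP[/andP[Bt _] _].
have t1 : (1 <= t)%N by exact: leq_trans Bt.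
rewrite /abU mulrCA.
have ab0 : 0 <= alpha t * beta t by rewrite mulr_ge0 ?ltW ?al0 ?be0.
apply: le_trans (ler_wpM2l ab0 (U_window Bt)) _.
rewrite mulr_sumr [leLHS]big_nat_cond [leRHS]big_nat_cond; apply: ler_sum.
move=> s /andP[/andP[ts st] _].
have s1 : (1 <= s)%N.
  by apply: leq_trans ts; rewrite subn_gt0 ltnW.
have as0 := al0 s1; have bs0 := be0 s1; have bs1 := be1 s1.
rewrite /a mulrCA ler_wpM2l//.
apply: (@le_trans _ _ (alpha s * beta s *
   (Q s + beta s ^+ 2 * (gam + alpha s ^+ 2 * G s)))).
  apply: ler_wpM2r; last exact/ab_dec/ltnW.
  rewrite addr_ge0 ?Q0// mulr_ge0 ?exprn_ge0// ?(ltW bs0)// addr_ge0//.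
  by rewrite mulr_ge0 ?G0// exprn_ge0// ltW.
have bb : beta s ^+ 2 <= beta s by rewrite expr2 ler_piMr// ltW.
have b2 : beta s ^+ 2 * gam <= Cb * alpha s ^+ 2 * gam.
  by rewrite ler_wpM2r// (le_trans bb)// be_al.
have b3 : beta s ^+ 2 * (alpha s ^+ 2 * G s) <= alpha s ^+ 2 * (G1 + G2 * U s).
  apply: le_trans (_ : 1 * (alpha s ^+ 2 * G s) <= _).
    rewrite ler_wpM2r ?(le_trans bb)//.
    by rewrite mulr_ge0 ?G0// exprn_ge0// ltW.
  by rewrite mul1r ler_wpM2l ?exprn_ge0 ?GU// ltW.
have h : Q s + beta s ^+ 2 * (gam + alpha s ^+ 2 * G s) <=
   Q s + (Cb * gam + G1) * alpha s ^+ 2 + G2 * (alpha s ^+ 2 * U s) by lra.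
have abs0 : 0 <= alpha s * beta s by rewrite mulr_ge0 ?ltW.
have := ler_wpM2l abs0 h.
by rewrite /abQ /a3bU /lam; lra.
Qed.

(** The bound on the disagreement returns a multiple [c] of the dispersion sum, and
    beyond some time the factor [alpha t ^+ 2 <= de] does the same for the part of
    [G] that grows with [U].  Both constants are chosen so that the multiples
    that come back are at most [kap / 4], and are absorbed on the left. *)
Lemma summed_dispersion_le : exists2 C : R, 0 <= C &
  forall T, psum abU T <= C * (1 + psum lam T).
Proof.
pose D := C1 * B%:R / (1 - b0).
have b1 : 0 < 1 - b0 by rewrite subr_gt0.
have D0 : 0 <= D by rewrite divr_ge0 ?mulr_ge0// ltW.
pose c := kap / (4 * (D + 1)).
have c0 : 0 < c by rewrite divr_gt0// mulr_gt0// ltr_wpDl.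
have ci0 : 0 <= c^-1 by rewrite invr_ge0 ltW.
have Dc : D * c <= kap / 4.
  rewrite /c [leLHS](_ : _ = (kap / 4) * (D / (D + 1))); last first.
    by field; rewrite gt_eqF// ltr_wpDl.
  rewrite ler_piMr ?divr_ge0 ?(ltW kap0)// ler_pdivrMr ?ltr_wpDl// mul1r lerDl//.
pose F := D * ((1 + c^-1) * G2) + C1 * B%:R * G2.
have F0 : 0 <= F by do ![done | apply: addr_ge0 | apply: mulr_ge0].
pose de := kap / (4 * (F + 1)).
have de0 : 0 < de by rewrite divr_gt0// mulr_gt0// ltr_wpDl.
have Fd : F * de <= kap / 4.
  rewrite /de [leLHS](_ : _ = (kap / 4) * (F / (F + 1))); last first.
    by field; rewrite gt_eqF// ltr_wpDl.
  rewrite ler_piMr ?divr_ge0 ?(ltW kap0)// ler_pdivrMr ?ltr_wpDl// mul1r lerDl//.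
have [t0 t0P] := al_small de0.
have VS T : psum a3bU T <= psum a3bU t0 + de * psum abU T.
  rewrite -psumZ; apply: psum_split_le => t t1.
  - by rewrite mulr_ge0 ?lam_ge0 ?U0.
  - by rewrite mulr_ge0 ?abU_ge0// ltW.
  have t1' : (1 <= t)%N by exact: leq_ltn_trans t1.
  have -> : a3bU t = alpha t ^+ 2 * abU t by rewrite /a3bU /lam /abU; ring.
  by rewrite ler_wpM2r ?abU_ge0// t0P.
pose S0 := psum abU B.+1; pose V0 := psum a3bU t0.
have S00 : 0 <= S0 by exact: psum_ge0.
have V00 : 0 <= V0 by apply: psum_ge0 => t t1; rewrite mulr_ge0 ?lam_ge0 ?U0.
pose K0 := kap * S0 + D * (alpha 1%N * U 1%N) + F * V0.
pose K1 := D * ((1 + c^-1) * G1 + Cb * gam) + C1 * B%:R * (Cb * gam + G1).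
have K00 : 0 <= K0.
  have aU0 : 0 <= alpha 1%N * U 1%N by rewrite mulr_ge0 ?U0// ltW// al0.
  by do ![done | exact: ltW | apply: addr_ge0 | apply: mulr_ge0].
have K10 : 0 <= K1.
  by do ![done | apply: addr_ge0 | apply: mulr_ge0].
exists ((K0 + K1) / (kap / 2)) => [|T].
  by apply: divr_ge0; [exact: addr_ge0|rewrite ltW// divr_gt0].
have L0 : 0 <= psum lam T by exact: psum_ge0.
have S_0 : 0 <= psum abU T by exact: psum_ge0.
set S := psum abU T in S_0 *; set L := psum lam T in L0 *.
have hQ : psum abQ T <= (1 - b0)^-1 * (alpha 1%N * U 1%N + c * S
    + (1 + c^-1) * (G1 * L + G2 * psum a3bU T) + Cb * gam * L).
  by rewrite ler_pdivlMl//; exact: sum_Q_le.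
have CB0 : 0 <= C1 * B%:R by rewrite mulr_ge0.
have hQ' := ler_wpM2l CB0 hQ.
have hU := sum_U_le T; rewrite -/S -/L in hU.
have hV := ler_wpM2l F0 (VS T); rewrite -/S -/V0 in hV.
have main : kap * S <= K0 + K1 * L + D * c * S + F * de * S.
  have -> : K0 + K1 * L + D * c * S + F * de * S =
     kap * S0 + (C1 * B%:R * ((1 - b0)^-1 * (alpha 1%N * U 1%N + c * S
    + (1 + c^-1) * (G1 * L + G2 * psum a3bU T) + Cb * gam * L)))
     + C1 * B%:R * ((Cb * gam + G1) * L + G2 * psum a3bU T)
     + (F * (V0 + de * S) - F * psum a3bU T).
    by rewrite /K0 /K1 /F /D; ring.
  have : C1 * (B%:R * (psum abQ T + (Cb * gam + G1) * L + G2 * psum a3bU T)) =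
     C1 * B%:R * psum abQ T +
     C1 * B%:R * ((Cb * gam + G1) * L + G2 * psum a3bU T) by ring.
  by move: hU => /[swap] ->; rewrite -/S0 => hU; lra.
have h1 : D * c * S <= kap / 4 * S by rewrite ler_wpM2r.
have h2 : F * de * S <= kap / 4 * S by rewrite ler_wpM2r.
rewrite mulrAC ler_pdivlMr ?divr_gt0//.
have : K0 + K1 * L <= (K0 + K1) * (1 + L).
  by have := mulr_ge0 K00 L0; lra.
lra.
Qed.

End summed_dispersion.

(** * Step sizes *)

Section step_sizes.
Context (R : realType) (alpha0 beta0 tau : R).
Hypotheses (al0_itv : 0 < alpha0 < 1) (be0_itv : 0 < beta0 < 1)
  (tau0 : 0 <= tau).
Notation alpha := (step_alpha alpha0 tau).
Notation beta := (step_beta beta0 tau).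

(** Both step sizes are rational functions of this sixth root of the time. *)
Let u (t : nat) : R := (t%:R + tau) `^ (1 / 6).
Let al0_gt0 : 0 < alpha0. Proof. by case/andP: al0_itv. Qed.
Let al0_lt1 : alpha0 < 1. Proof. by case/andP: al0_itv. Qed.
Let be0_gt0 : 0 < beta0. Proof. by case/andP: be0_itv. Qed.
Let be0_lt1 : beta0 < 1. Proof. by case/andP: be0_itv. Qed.

Let t_tau_ge0 t : 0 <= t%:R + tau. Proof. by rewrite addr_ge0. Qed.

Let t_tau_ge1 t : (1 <= t)%N -> 1 <= t%:R + tau.
Proof. by move=> t1; rewrite -[leLHS]addr0 lerD ?ler1n. Qed.

Let uX t k : u t ^+ k = (t%:R + tau) `^ (k%:R / 6).
Proof. by rewrite -powR_mulrn ?powR_ge0// -powRrM mul1r mulrC. Qed.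

Let u6 t : u t ^+ 6 = t%:R + tau.
Proof. by rewrite uX divff// powRr1. Qed.

Let u_ge1 t : (1 <= t)%N -> 1 <= u t.
Proof.
by move=> t1; rewrite -(@expr_ge1 _ 6) ?powR_ge0// u6 t_tau_ge1.
Qed.

Let u_gt0 t : (1 <= t)%N -> 0 < u t.
Proof. by move=> t1; rewrite (lt_le_trans _ (u_ge1 t1)). Qed.

Let u_mono s t : (s <= t)%N -> u s <= u t.
Proof.
move=> st; rewrite -(@ler_pXn2r _ 6) ?nnegrE ?powR_ge0// !u6.
by rewrite lerD2r ler_nat.
Qed.

Let alphaE t : alpha t = alpha0 / u t. Proof. by []. Qed.

Let betaE t : beta t = beta0 / u t ^+ 3.
Proof. by rewrite uX /step_beta; congr (_ / _ `^ _); field. Qed.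

Lemma step_alpha_gt0 t : (1 <= t)%N -> 0 < alpha t.
Proof. by move=> t1; rewrite alphaE divr_gt0// u_gt0. Qed.

Lemma step_alpha_le1 t : (1 <= t)%N -> alpha t <= 1.
Proof.
move=> t1; rewrite alphaE ler_pdivrMr ?u_gt0// mul1r.
by rewrite (le_trans (ltW al0_lt1))// u_ge1.
Qed.

Lemma step_alpha_dec t : (1 <= t)%N -> alpha t.+1 <= alpha t.
Proof.
by move=> t1; rewrite !alphaE ler_pM2l// lef_pV2 ?posrE ?u_gt0// u_mono.
Qed.

Lemma step_beta_gt0 t : (1 <= t)%N -> 0 < beta t.
Proof. by move=> t1; rewrite betaE divr_gt0// exprn_gt0// u_gt0. Qed.

Lemma step_beta_le t : (1 <= t)%N -> beta t <= beta0.
Proof.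
move=> t1; rewrite betaE ler_pdivrMr ?exprn_gt0 ?u_gt0//.
by rewrite ler_peMr ?(ltW be0_gt0)// expr_ge1 ?u_ge1 ?(ltW (u_gt0 t1)).
Qed.

Let alphabetaE t : alpha t * beta t = alpha0 * beta0 / u t ^+ 4.
Proof. by rewrite alphaE betaE mulf_div -exprS. Qed.

Lemma step_alphabeta_dec s t : (1 <= s)%N -> (s <= t)%N ->
  alpha t * beta t <= alpha s * beta s.
Proof.
move=> s1 st; have t1 := leq_trans s1 st.
rewrite !alphabetaE ler_pM2l ?mulr_gt0//.
rewrite lef_pV2 ?posrE ?exprn_gt0 ?u_gt0//.
by rewrite lerXn2r ?nnegrE ?powR_ge0// u_mono.
Qed.

Lemma step_beta_le_alpha t : (1 <= t)%N ->
  beta t <= beta0 / alpha0 ^+ 2 * alpha t ^+ 2.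
Proof.
move=> t1; have u0 := u_gt0 t1.
have -> : beta0 / alpha0 ^+ 2 * alpha t ^+ 2 = beta0 / u t ^+ 2.
  by rewrite alphaE; field; rewrite !gt_eqF.
rewrite betaE ler_pM2l// lef_pV2 ?posrE ?exprn_gt0//.
by rewrite [leRHS]exprS ler_peMl ?u_ge1// exprn_ge0// ltW.
Qed.

Lemma step_beta_sqr t : (1 <= t)%N ->
  beta t ^+ 2 = beta0 / alpha0 ^+ 3 * (alpha t ^+ 3 * beta t).
Proof.
move=> t1; have u0 := u_gt0 t1.
by rewrite alphaE betaE; field; rewrite !gt_eqF.
Qed.

Lemma step_alpha_small (de : R) : 0 < de ->
  exists t0, forall t, (t0 < t)%N -> alpha t ^+ 2 <= de.
Proof.
move=> de0; pose t0 := Num.truncn (de^-1 ^+ 3).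
exists t0 => t t0t; have t1 : (1 <= t)%N by exact: leq_ltn_trans t0t.
have u0 := u_gt0 t1.
have h : de^-1 ^+ 3 <= (u t ^+ 2) ^+ 3.
  rewrite -exprM u6; apply: le_trans (ltW (truncnS_gt _)) _.
  by apply: le_trans (_ : t%:R <= _); rewrite ?ler_nat// lerDl.
have h' : de^-1 <= u t ^+ 2.
  by move: h; rewrite ler_pXn2r ?nnegrE ?exprn_ge0 ?invr_ge0// ltW.
apply: le_trans (_ : (u t ^+ 2)^-1 <= _).
  rewrite alphaE expr_div_n ler_piMl ?invr_ge0 ?exprn_ge0 ?(ltW u0)//.
  by rewrite expr_le1// ltW.
by rewrite -[leRHS]invrK lef_pV2 ?posrE ?invr_gt0 ?exprn_gt0.
Qed.

(** By [ln (1 + y) <= y] at [y = - 1 / (T + 1)], each new term is at most the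
    increment of the logarithm. *)
Lemma harmonic_le_ln T : (1 <= T)%N ->
  psum (fun t => t%:R^-1) T <= 1 + ln (T%:R : R).
Proof.
elim: T => // -[|T] IH _.
  by rewrite psumS psum0 invr1 ln1 add0r addr0.
rewrite psumS /=; have := IH isT; set s := psum _ _ => hs.
suff : ln (T.+1%:R : R) - ln T.+2%:R <= - T.+2%:R^-1.
  by move: T.+2%:R^-1 (ln T.+2%:R) (ln T.+1%:R) hs => v y z; lra.
rewrite -ln_div ?posrE ?ltr0n//.
have -> : T.+1%:R / T.+2%:R = 1 + - T.+2%:R^-1 :> R.
  have n0 : T.+2%:R != 0 :> R by rewrite pnatr_eq0.
  apply: (mulIf n0); rewrite divfK// mulrDl mul1r mulNr mulVf//.
  by rewrite -(natr1 T.+1) addrK.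
by apply: le_ln1Dx; rewrite ltrN2 invf_lt1 ?ltr1n// ltr0n.
Qed.

Lemma psum_lam_le (eps : R) T : 0 < eps -> (1 <= T)%N ->
  1 + psum (fun t => alpha t ^+ 3 * beta t) T <=
    (2 + eps^-1) * T%:R `^ eps.
Proof.
move=> eps0 T1.
have T0 : 0 < T%:R :> R by rewrite ltr0n.
have h1 : psum (fun t => alpha t ^+ 3 * beta t) T <= psum (fun t => t%:R^-1) T.
  apply: psum_le => t t1; have u0 := u_gt0 t1.
  have -> : alpha t ^+ 3 * beta t = alpha0 ^+ 3 * beta0 / (t%:R + tau).
    by rewrite -u6 alphaE betaE; field; rewrite gt_eqF.
  rewrite -[leRHS]mul1r; apply: ler_pM.
  - by rewrite mulr_ge0 ?exprn_ge0 ?ltW.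
  - by rewrite invr_ge0.
  - by rewrite mulr_ile1 ?exprn_ge0 ?exprn_ile1// ?ltW.
  - by rewrite lef_pV2 ?posrE ?lerDl// ?ltr_wpDr ?ltr0n.
have h2 := harmonic_le_ln T1.
(* [ln y < y] at [y = T `^ eps] *)
have h3 : ln (T%:R : R) <= eps^-1 * T%:R `^ eps.
  rewrite ler_pdivlMl// -ln_powR.
  by rewrite ltW// ln_sublinear// powR_gt0.
have h4 : 1 <= T%:R `^ eps :> R.
  by rewrite -[leLHS](powRr0 T%:R) ler_powR ?ler1n// ltW.
lra.
Qed.

(** The weights [alpha t * beta t] decrease like [t `^ (- 2 / 3)], so that
    removing them from a sum up to [T] costs a factor [T `^ (2 / 3)]. *)
Lemma average_rate (a : nat -> R) (C eps : R) : 0 < eps ->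
  (forall t, (1 <= t)%N -> 0 <= a t) -> 0 <= C ->
  (forall T, psum (fun t => alpha t * beta t * a t) T <=
     C * (1 + psum (fun t => alpha t ^+ 3 * beta t) T)) ->
  exists C', forall T, (1 <= T)%N ->
    T%:R^-1 * psum a T <= C' * T%:R `^ (- (1 / 3) + eps).
Proof.
move=> eps0 a0 C0 sumC.
exists ((1 + tau) `^ (2 / 3) / (alpha0 * beta0) * (C * (2 + eps^-1))) => T T1.
have T0 : 0 < T%:R :> R by rewrite ltr0n.
have ab0 : 0 < alpha T * beta T.
  by rewrite mulr_gt0 ?step_alpha_gt0 ?step_beta_gt0.
have h1 : psum a T <=
    (alpha T * beta T)^-1 * (C * ((2 + eps^-1) * T%:R `^ eps)).
  rewrite ler_pdivlMl// -psumZ; apply: le_trans (le_trans _ (sumC T)) _.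
    rewrite /psum [leLHS]big_nat_cond [leRHS]big_nat_cond.
    apply: ler_sum => t /andP[/andP[t1 tT] _].
    by rewrite ler_wpM2r ?a0// step_alphabeta_dec.
  by rewrite ler_wpM2l// psum_lam_le.
have h2 : (alpha T * beta T)^-1 <=
    (1 + tau) `^ (2 / 3) / (alpha0 * beta0) * T%:R `^ (2 / 3).
  rewrite alphabetaE invf_div mulrC [leRHS]mulrAC mulrC.
  rewrite ler_pM2r ?invr_gt0 ?mulr_gt0// uX.
  have -> : (4 / 6 = 2 / 3 :> R) by field.
  rewrite -powRM ?addr_ge0//; apply: ge0_ler_powR; rewrite ?nnegrE//.
  - by rewrite mulr_ge0 ?addr_ge0.
  - by rewrite mulrDl mul1r lerD2l ler_peMr ?ler1n.
have pe : T%:R `^ (- (1 / 3) + eps) = T%:R^-1 * (T%:R `^ (2 / 3) * T%:R `^ eps) :> R.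
  have -> : - (1 / 3) + eps = - 1 + (2 / 3 + eps) :> R by field.
  by rewrite !powRD ?powR_inv1 ?pnatr_eq0 -?lt0n ?T1 ?implybT.
rewrite pe mulrCA ler_pM2l ?invr_gt0//.
apply: (le_trans h1).
set X := C * (_ * T%:R `^ eps).
apply: (@le_trans _ _ ((1 + tau) `^ (2 / 3) / (alpha0 * beta0) *
    T%:R `^ (2 / 3) * X)).
  have e0 : 0 <= eps^-1 by rewrite invr_ge0 ltW.
  by apply: ler_wpM2r => //; rewrite /X mulr_ge0// mulr_ge0 ?powR_ge0 ?addr_ge0.
by rewrite /X le_eqVlt; apply/orP; left; apply/eqP; ring.
Qed.

End step_sizes.

(** * Random vectors and laws *)

Lemma measurable_borel_coord (R : realType) (n : nat) (k : 'I_n) :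
  measurable_fun [set: borel_rV R n] (fun v : borel_rV R n => (v : 'rV[R]_n) 0 k).
Proof.
apply: (measurability _ (RGenOpens.measurableE R)) => _ [_ [a [b ->] <-]].
apply: sub_sigma_algebra; rewrite setTI.
have : continuous (fun v : 'rV[R]_n => v 0 k) by move=> v; exact: coord_continuous.
move=> /continuousP; apply; exact: interval_open.
Qed.

(** Derivability turns the derivative into a limit of difference quotients along
    the sequence [1 / (m + 1)]. *)
Lemma measurable_partial (dT : measure_display) (T : measurableType dT)
    (R : realType) (n : nat) (l : 'rV[R]_n -> T -> R) (y v : 'rV[R]_n) :
  (forall y, measurable_fun setT (l y)) ->
  (forall z, derivable (l^~ z) y v) ->
  measurable_fun setT (fun z => 'D_v (l^~ z) y).
Proof.
move=> ml dl.
apply: (@measurable_fun_cvg _ _ _ _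
  (fun m z => m.+1%:R * (l (m.+1%:R^-1 *: v + y) z - l y z))).
  move=> m; apply: measurable_funM => //; exact: measurable_funB.
move=> z _.
have /cvgr_dnbhsP/(_ (fun m => m.+1%:R^-1)) := dl z.
have -> : (fun m => (m.+1%:R^-1)^-1 *:
     ((l^~ z \o shift y) (m.+1%:R^-1 *: v) - l y z)) =
   (fun m => m.+1%:R * (l (m.+1%:R^-1 *: v + y) z - l y z)).
  by apply/funext => m /=; rewrite invrK.
apply; split=> [m|]; first by rewrite invr_eq0 pnatr_eq0.
exact: cvg_harmonic.
Qed.

Section transfer.
Context (dO : measure_display) (Omega : measurableType dO) (R : realType)
  (P : probability Omega R).

(** The integral of a nonnegative function always makes sense, so that a finite
    bound for it is an integrability statement. *)
Lemma L1_of_expectation (h : Omega -> R) (c : R) :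
  measurable_fun setT h -> (forall w, 0 <= h w) -> ('E_P[h] <= c%:E)%E ->
  L1 P h /\ Ex P h <= c.
Proof.
move=> mh h0 hc.
have lh : L1 P h.
  apply/integrableP; split; first exact/measurable_EFinP.
  rewrite unlock in hc; apply: le_lt_trans (ltry c); apply: le_trans hc.
  by rewrite le_eqVlt; apply/orP; left; apply/eqP/eq_integral => w _ /=;
    rewrite ger0_norm.
by split=> //; rewrite -lee_fin -Ex_EFin.
Qed.

Context (dT : measure_display) (T : measurableType dT) (Q : probability T R)
  (X : {RV P >-> T}).
Hypothesis XQ : forall A, measurable A -> distribution P X A = Q A.

Lemma law_integral (h : T -> R) : measurable_fun setT h ->
  L1 P (h \o X) -> (\int[Q]_z (h z)%:E = (Ex P (h \o X))%:E)%E.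
Proof.
move=> mh lh; rewrite -Ex_EFin// unlock.
rewrite -(integral_distribution (X := X) (f := EFin \o h))//; last first.
  exact/measurable_EFinP.
by apply: eq_measure_integral => A mA _; exact/esym/XQ.
Qed.

Lemma law_L1 (h : T -> R) : Q.-integrable setT (EFin \o h) -> L1 P (h \o X).
Proof.
move=> /integrableP[mh hoo]; apply/integrableP; split.
  exact: (measurableT_comp mh (measurable_funPT X)).
apply: le_lt_trans hoo.
rewrite le_eqVlt; apply/orP; left; apply/eqP.
have -> : (\int[Q]_z `|(EFin \o h) z| = \int[distribution P X]_z `|(EFin \o h) z|)%E.
  by apply: eq_measure_integral => A mA _; exact/esym/XQ.
rewrite (@ge0_integral_distribution _ _ _ _ _ P X (abse \o (EFin \o h)))//.
  by apply: measurableT_comp.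
by move=> z; exact: abse_ge0.
Qed.

End transfer.

(** * The algorithm *)

Section measurable_wrt_closure.
Context (dO : measure_display) (Omega : measurableType dO) (R : realType)
  (G : set (set Omega)).
Implicit Types (f g : Omega -> R).

Lemma wrt_cst (c : R) : measurable_wrt G (fun=> c : R).
Proof. exact: measurable_cst. Qed.

Lemma wrtD f g : measurable_wrt G f -> measurable_wrt G g ->
  measurable_wrt G (fun w => f w + g w).
Proof. exact: measurable_funD. Qed.

Lemma wrtB f g : measurable_wrt G f -> measurable_wrt G g ->
  measurable_wrt G (fun w => f w - g w).
Proof. exact: measurable_funB. Qed.

Lemma wrtM f g : measurable_wrt G f -> measurable_wrt G g ->
  measurable_wrt G (fun w => f w * g w).
Proof. exact: measurable_funM. Qed.

Lemma wrtZ c f : measurable_wrt G f -> measurable_wrt G (fun w => c * f w).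
Proof. by move=> mf; apply: wrtM mf; exact: wrt_cst. Qed.

Lemma wrt_sum (I : Type) (s : seq I) (f : I -> Omega -> R) :
  (forall i, measurable_wrt G (f i)) ->
  measurable_wrt G (fun w => \sum_(i <- s) f i w).
Proof. by move=> mf; exact: measurable_sum. Qed.

Lemma wrt_sqnorm n (v : Omega -> 'rV[R]_n) :
  (forall k, measurable_wrt G (fun w => v w 0 k)) ->
  measurable_wrt G (fun w => sqnorm (v w)).
Proof. by move=> mv; apply: wrt_sum => k; exact: measurable_funX (mv k). Qed.

Lemma wrt_borel_coord n (v : Omega -> borel_rV R n) k : measurable_wrt G v ->
  measurable_wrt G (fun w => (v w : 'rV[R]_n) 0 k).
Proof.
move=> mv; have := measurableT_comp (measurable_borel_coord k) mv. exact.
Qed.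

End measurable_wrt_closure.

Section dimix_analysis.
Context (R : realType) (dO : measure_display) (Omega : measurableType dO)
  (P : probability Omega R) (d p n N : nat)
  (l : 'rV[R]_d -> 'rV[R]_p -> R) (Pxi : probability (borel_rV R p) R)
  (xi : 'I_N -> {RV P >-> borel_rV R p})
  (r : 'cV[R]_n) (own : 'I_N -> 'I_n) (W : nat -> 'M[R]_n)
  (F : nat -> set (set Omega))
  (e : nat -> 'I_n -> {RV P >-> borel_rV R d})
  (x : nat -> 'I_n -> Omega -> 'rV[R]_d)
  (xstar : Omega -> 'rV[R]_d)
  (alpha0 beta0 tau gamma eta K sigma : R) (B : nat).
Hypotheses (N_gt0 : (0 < N)%N)
  (r_gt0 : forall i, 0 < r i 0) (r_sum1 : \sum_(i < n) r i 0 = 1)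
  (shardsP : forall i, (shard_size own i)%:R = r i 0 * N%:R)
  (sampleP : iid_sample Pxi xi)
  (xstar_min : forall w y,
    global_loss l r own (fun j => xi j w) (xstar w)
      <= global_loss l r own (fun j => xi j w) y)
  (xstar_int : P.-integrable setT
    (fun w => (global_loss l r own (fun j => xi j w) (xstar w))%:E))
  (alpha0_int : 0 < alpha0 < 1) (beta0_int : 0 < beta0 < 1) (tau_ge0 : 0 <= tau)
  (xP : dimix l own (fun w j => xi j w) W
          (step_alpha alpha0 tau) (step_beta beta0 tau) e x)
  (noiseP : noise_assumption xi F x e gamma)
  (connP : connectivity_assumption r W eta B)
  (lossP : loss_assumption l Pxi own xi x K sigma).

Let r_ge0 i : 0 <= r i 0. Proof. exact: ltW. Qed.
Let al := step_alpha alpha0 tau.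
Let be := step_beta beta0 tau.
Let H := K ^+ 2.
Let H_ge0 : 0 <= H. Proof. exact: sqr_ge0. Qed.
Let floc i w := local_loss l own (fun j => xi j w) i.
Let f w := global_loss l r own (fun j => xi j w).
Let gl j w y := grad (fun u => l u (xi j w)) y.
Let L := expected_loss l Pxi.
Let g t i w := grad (floc i w) (x t i w).
Let ev t i w : 'rV[R]_d := e t i w.
Let xb t w := xbar r x t w.

(** Giving weight zero to the samples of the other agents turns the mean over a
    shard into a convex combination of all the samples. *)
Let share i j : R := (own j == i)%:R / (shard_size own i)%:R.

Let share_ge0 i j : 0 <= share i j.
Proof. by rewrite divr_ge0. Qed.

Let share_sum1 i : \sum_j share i j = 1.
Proof.
rewrite -mulr_suml -natr_sum.
have -> : (\sum_(j < N) (own j == i) = shard_size own i)%N.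
  by rewrite /shard_size -sum1dep_card [RHS]big_mkcond.
by rewrite divff// shardsP gt_eqF// mulr_gt0// ltr0n.
Qed.

Let l_diff y z : differentiable (fun u => l u z) y.
Proof. by case: lossP. Qed.

Let flocE i w : floc i w = (fun y => 1 * \sum_j share i j * l y (xi j w)).
Proof.
apply/funext => y; rewrite mul1r /floc /local_loss mulr_sumr big_mkcond.
apply: eq_bigr => j _; rewrite /share; case: eqP => _; last by rewrite !mul0r.
by rewrite div1r.
Qed.

Let fE w : f w = (fun y => 1 * \sum_i r i 0 * floc i w y).
Proof. by apply/funext => y; rewrite mul1r. Qed.

Let floc_diff i w y : differentiable (floc i w) y.
Proof. by rewrite flocE; apply: differentiable_lincomb. Qed.

Let f_diff w y : differentiable (f w) y.
Proof. by rewrite fE; exact: differentiable_lincomb. Qed.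

Let grad_floc i w y : grad (floc i w) y = \sum_j share i j *: gl j w y.
Proof.
rewrite flocE (@grad_lincomb _ _ _ xpredT 1 (share i) (fun j u => l u (xi j w)))//.
by rewrite scale1r.
Qed.

Let grad_f w y : grad (f w) y = \sum_i r i 0 *: grad (floc i w) y.
Proof.
rewrite fE (@grad_lincomb _ _ _ xpredT 1 (fun i => r i 0) (fun i => floc i w))//.
by rewrite scale1r.
Qed.

Let gl_lip j w y y' : sqnorm (gl j w y - gl j w y') <= H * sqnorm (y - y').
Proof. by case: lossP => _ _ _ h _; apply: enorm_le_sqnorm; exact: h. Qed.

Let floc_lip i w y y' :
  sqnorm (grad (floc i w) y - grad (floc i w) y') <= H * sqnorm (y - y').
Proof.
rewrite !grad_floc -sumrB; under eq_bigr do rewrite -scalerBr.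
apply: le_trans (sqnorm_wmean_le _ (share_ge0 i) (share_sum1 i)) _.
rewrite -[leRHS]mul1r -(share_sum1 i) mulr_suml; apply: ler_sum => j _.
by rewrite ler_wpM2l.
Qed.

Let f_lip w y y' :
  sqnorm (grad (f w) y - grad (f w) y') <= H * sqnorm (y - y').
Proof.
rewrite !grad_f -sumrB; under eq_bigr do rewrite -scalerBr.
apply: le_trans (sqnorm_wmean_le _ r_ge0 r_sum1) _.
rewrite -[leRHS]mul1r -r_sum1 mulr_suml; apply: ler_sum => i _.
by rewrite ler_wpM2l.
Qed.

Let F_filt : filtration F. Proof. by case: noiseP. Qed.
Let F_sigma t : sigma_algebra setT (F t). Proof. by case: F_filt. Qed.
Let F_sub t : F t `<=` measurable. Proof. by case: F_filt. Qed.

Let F_measurable t (h : Omega -> R) : measurable_wrt (F t) h -> measurable_fun setT h.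
Proof. exact: measurable_wrt_measurable. Qed.

Let xi_wrt t j : (1 <= t)%N -> measurable_wrt (F t) (xi j : Omega -> borel_rV R p).
Proof.
move=> t1; case: F_filt => _ _ mono; case: noiseP => _ mxi _ _ _.
exact: measurable_wrt_sub (mono _ _ t1) (mxi j).
Qed.

Let x_wrt t i k : (1 <= t)%N -> measurable_wrt (F t) (fun w => x t i w 0 k).
Proof.
by move=> t1; case: noiseP => _ _ mx _ _; apply: wrt_borel_coord; exact: mx.
Qed.

Let l_measurable y : measurable_fun [set: borel_rV R p] (l y).
Proof. by case: lossP => li _ _ _ _; have /measurable_int/measurable_EFinP := li y. Qed.

Let partial_measurable y (k : 'I_d) :
  measurable_fun [set: borel_rV R p] (fun z => grad (fun u => l u z) y 0 k).
Proof.
have -> : (fun z => grad (fun u => l u z) y 0 k) =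
    (fun z => 'D_(delta_mx 0 k) (fun u => l u z) y).
  by apply/funext => z; rewrite mxE.
apply: (@measurable_partial _ (borel_rV R p)) => [//|z].
exact/diff_derivable.
Qed.

Let gl_coord_measurable t y j (k : 'I_d) : (1 <= t)%N ->
  measurable_wrt (F t) (fun w => gl j w y 0 k).
Proof.
by move=> t1; exact: (measurableT_comp (partial_measurable y k) (xi_wrt j t1)).
Qed.

Let gl_coord_lip j w (k : 'I_d) y y' :
  (gl j w y 0 k - gl j w y' 0 k) ^+ 2 <= H * sqnorm (y - y').
Proof.
apply: le_trans (gl_lip j w y y').
by have := sqr_coord_le (gl j w y - gl j w y') k; rewrite !mxE.
Qed.

Let gl_wrt t j (k : 'I_d) (X : Omega -> 'rV[R]_d) : (1 <= t)%N ->
  (forall k, measurable_wrt (F t) (fun w => X w 0 k)) ->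
  measurable_wrt (F t) (fun w => gl j w (X w) 0 k).
Proof.
move=> t1 mX; apply: (@measurable_caratheodory_comp _ (g_sigma_algebraType (F t))
  R d (fun y w => gl j w y 0 k) X) => // [y|w].
  exact: gl_coord_measurable.
exact: (sqr_lipschitz_continuous (gl_coord_lip j w k)).
Qed.

Let l_wrt t j (X : Omega -> 'rV[R]_d) : (1 <= t)%N ->
  (forall k, measurable_wrt (F t) (fun w => X w 0 k)) ->
  measurable_wrt (F t) (fun w => l (X w) (xi j w)).
Proof.
move=> t1 mX; apply: (@measurable_caratheodory_comp _ (g_sigma_algebraType (F t))
  R d (fun y w => l y (xi j w)) X) => // [y|w].
  exact: (measurableT_comp (l_measurable y) (xi_wrt j t1)).
by move=> y; apply: differentiable_continuous.
Qed.

Let x1 i w : x 1%N i w = 0. Proof. by case: xP. Qed.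

Let dev_wrt_coord t i j k : (1 <= t)%N ->
  measurable_wrt (F t) (fun w => gl j w (x t i w) 0 k).
Proof. by move=> t1; apply: gl_wrt => // k'; exact: x_wrt. Qed.

(** All the agents start from zero, where the variance bound at the iterates gives
    square integrability; smoothness carries it to every [y].  The integral
    under [Pxi] may then be computed from a single sample point. *)
Let gradL_expectation j y (k : 'I_d) :
  L2 P (fun w => gl j w y 0 k) /\ grad L y 0 k = Ex P (fun w => gl j w y 0 k).
Proof.
have l0 : L2 P (fun w => gl j w 0 0 k).
  have [_ _ _ _ [_ _ /(_ 1%N (own j) j isT erefl) h]] := lossP.
  have [] := L1_of_expectation _ _ h.
  - apply: (@F_measurable 1); apply: wrt_sqnorm => k'.
    have -> : (fun w => (gl j w (x 1 (own j) w) - grad L (x 1 (own j) w)) 0 k')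
        = (fun w => gl j w 0 0 k' - grad L 0 0 k').
      by apply/funext => w; rewrite x1 !mxE.
    by apply: wrtB; [exact: gl_coord_measurable|exact: wrt_cst].
  - by move=> w; exact: sqnorm_ge0.
  move=> lh _.
  apply: (@L2_eq _ _ _ _ (fun w => (gl j w 0 0 k - grad L 0 0 k) + grad L 0 0 k)).
    by move=> w; rewrite subrK.
  apply: L2D; last exact: L2_cst.
  apply: L2_le lh _ => [|w].
    apply: (@F_measurable 1); apply: wrtB; last exact: wrt_cst.
    exact: gl_coord_measurable.
  have := sqr_coord_le (gl j w (x 1 (own j) w) - grad L (x 1 (own j) w)) k.
  by rewrite x1 !mxE.
have ly : L2 P (fun w => gl j w y 0 k).
  apply: (@L2_eq _ _ _ _ (fun w => (gl j w y 0 k - gl j w 0 0 k) + gl j w 0 0 k)).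
    by move=> w; rewrite subrK.
  apply: L2D => //; apply: L2_le (L1_cst P (H * sqnorm (y - 0))) _ => [|w].
    apply: (@F_measurable 1).
    by apply: wrtB; exact: gl_coord_measurable.
  exact: gl_coord_lip.
split=> //.
have ly1 : L1 P (fun w => gl j w y 0 k).
  by apply: L1_eq (L2_mul ly (L2_cst P 1)) => w; rewrite mulr1.
have [_ _ _ _ [/(_ y k) h _ _]] := lossP.
case: sampleP => _ /(_ j) dist.
have := law_integral dist (partial_measurable y k) ly1.
by rewrite unlock in h; rewrite h => -[].
Qed.

Let gradL_coord_lip y y' (k : 'I_d) :
  (grad L y 0 k - grad L y' 0 k) ^+ 2 <= H * sqnorm (y - y').
Proof.
pose j : 'I_N := Ordinal N_gt0.
have [l2 ->] := gradL_expectation j y k; have [l2' ->] := gradL_expectation j y' k.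
have L2L1 h : L2 P h -> L1 P h.
  by move=> lh; apply: L1_eq (L2_mul lh (L2_cst P 1)) => w; rewrite mulr1.
rewrite -ExB; [|exact: L2L1|exact: L2L1].
have hs : 0 <= H * sqnorm (y - y') by rewrite mulr_ge0 ?sqnorm_ge0.
have pt w : `|gl j w y 0 k - gl j w y' 0 k| <= Num.sqrt (H * sqnorm (y - y')).
  by rewrite -sqrtr_sqr ler_sqrt// gl_coord_lip.
have lB := L1B (L2L1 _ l2) (L2L1 _ l2').
rewrite -[leRHS]sqr_sqrtr// -real_normK ?num_real// lerXn2r ?nnegrE ?sqrtr_ge0//.
rewrite ler_norml; apply/andP; split.
  rewrite -[leLHS](Ex_cst P); apply: Ex_le => // [|w]; first exact: L1_cst.
  by have := pt w; rewrite ler_norml => /andP[].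
rewrite -[leRHS](Ex_cst P); apply: Ex_le => // [|w]; first exact: L1_cst.
by have := pt w; rewrite ler_norml => /andP[].
Qed.

Let gradL_lip y y' :
  sqnorm (grad L y - grad L y') <= d%:R * (H * sqnorm (y - y')).
Proof.
rewrite /sqnorm -/(sqnorm (y - y')).
have -> : d%:R * (H * sqnorm (y - y')) = \sum_(k < d) (H * sqnorm (y - y')).
  by rewrite sumr_const card_ord mulr_natl.
by apply: ler_sum => k _; rewrite rowB_coord gradL_coord_lip.
Qed.

Let gradL_wrt t (k : 'I_d) (X : Omega -> 'rV[R]_d) : (1 <= t)%N ->
  (forall k, measurable_wrt (F t) (fun w => X w 0 k)) ->
  measurable_wrt (F t) (fun w => grad L (X w) 0 k).
Proof.
move=> t1 mX; apply: (@measurable_caratheodory_comp _ (g_sigma_algebraType (F t))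
  R d (fun y w => grad L y 0 k) X) => // w.
exact: (sqr_lipschitz_continuous (fun y y' => gradL_coord_lip y y' k)).
Qed.

Let dev t i j w := sqnorm (gl j w (x t i w) - grad L (x t i w)).

Let dev_L1 t i j : (1 <= t)%N -> own j = i ->
  L1 P (dev t i j) /\ Ex P (dev t i j) <= sigma ^+ 2.
Proof.
move=> t1 ji; have [_ _ _ _ [_ _ /(_ t i j t1 ji) h]] := lossP.
apply: L1_of_expectation h => [|w]; last exact: sqnorm_ge0.
apply: (@F_measurable t); apply: wrt_sqnorm => k.
have -> : (fun w => (gl j w (x t i w) - grad L (x t i w)) 0 k) =
    (fun w => gl j w (x t i w) 0 k - grad L (x t i w) 0 k).
  by apply/funext => w; rewrite !mxE.
by apply: wrtB; [exact: dev_wrt_coord|apply: gradL_wrt => // k'; exact: x_wrt].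
Qed.

Let L1_sqnorm (X : Omega -> 'rV[R]_d) :
  (forall k, L2 P (fun w => X w 0 k)) -> L1 P (fun w => sqnorm (X w)).
Proof. by move=> lX; apply: L1_sum => k _; exact: L2_sqr. Qed.

(** Being Lipschitz, [grad L] grows at most linearly. *)
Let gradL_L2 t (X : Omega -> 'rV[R]_d) (k : 'I_d) : (1 <= t)%N ->
  (forall k, measurable_wrt (F t) (fun w => X w 0 k)) ->
  (forall k, L2 P (fun w => X w 0 k)) -> L2 P (fun w => grad L (X w) 0 k).
Proof.
move=> t1 mX lX.
apply: L2_le (L1D (L1Z (2 * H) (L1_sqnorm lX)) (L1_cst P (2 * grad L 0 0 k ^+ 2))) _.
  by apply: (@F_measurable t); exact: gradL_wrt.
move=> w; have := sqr_le_dist (gradL_coord_lip (X w) 0 k).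
by rewrite subr0 mulrA.
Qed.

Let g_coord t i w k : g t i w 0 k = \sum_j share i j * gl j w (x t i w) 0 k.
Proof. by rewrite /g grad_floc summxE; apply: eq_bigr => j _; rewrite mxE. Qed.

Let g_wrt t i k : (1 <= t)%N -> measurable_wrt (F t) (fun w => g t i w 0 k).
Proof.
move=> t1; have -> : (fun w => g t i w 0 k) =
    (fun w => \sum_j share i j * gl j w (x t i w) 0 k).
  by apply/funext => w; exact: g_coord.
by apply: wrt_sum => j; apply: wrtZ; exact: dev_wrt_coord.
Qed.

(** A sample gradient is its deviation from [grad L], bounded by the variance at
    the iterates, plus [grad L], which [gradL_L2] takes care of.  The variance
    is known for the samples of agent [i] only, the others have weight zero. *)
Let g_L2_of_x t i : (1 <= t)%N -> (forall k, L2 P (fun w => x t i w 0 k)) ->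
  forall k, L2 P (fun w => g t i w 0 k).
Proof.
move=> t1 lx k.
apply: (L2_eq (f := fun w => \sum_j share i j * gl j w (x t i w) 0 k)).
  by move=> w; rewrite g_coord.
apply: L2_sum => j _; have [ji|ji] := eqVneq (own j) i; last first.
  by apply: L2_eq (L2_cst P 0) => w; rewrite /share (negbTE ji) !mul0r.
apply: L2Z; have lL : L2 P (fun w => grad L (x t i w) 0 k).
  by apply: (gradL_L2 k t1) => // k'; exact: x_wrt.
apply: (L2_eq (f := fun w => (gl j w (x t i w) 0 k - grad L (x t i w) 0 k)
                             + grad L (x t i w) 0 k)).
  by move=> w; rewrite subrK.
apply: L2D => //; have [lD _] := dev_L1 t1 ji; apply: L2_le lD _ => [|w].
  apply: (@F_measurable t); apply: wrtB; first exact: dev_wrt_coord.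
  by apply: gradL_wrt => // k'; exact: x_wrt.
have := sqr_coord_le (gl j w (x t i w) - grad L (x t i w)) k.
by rewrite !mxE.
Qed.

Let ev_measurable t i k : measurable_fun setT (fun w => ev t i w 0 k).
Proof.
exact: (measurableT_comp (measurable_borel_coord k) (measurable_funPT (e t i))).
Qed.

(** The conditional variance bound holds almost surely only; capping the
    conditional expectation at [gamma] does not change its integral. *)
Let ev_sq t i : (1 <= t)%N -> L1 P (fun w => sqnorm (ev t i w)) /\
  Ex P (fun w => sqnorm (ev t i w)) <= gamma.
Proof.
move=> t1; have [_ _ _ _ [gam0 /(_ t i t1) [Z [le lZ mZ eZ] Zg]]] := noiseP.
split=> //.
have mZ' := L1_measurable lZ.
pose Y w := Num.min (Z w) gamma.
have mY : measurable_fun setT Y by exact: measurable_minr.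
have lY : L1 P Y.
  apply: L1_le (L1D (L1_norm lZ) (L1_cst P gamma)) _ => // w.
  rewrite /Y minEle; case: ifP => _; first by rewrite lerDl ltW.
  by rewrite (gtr0_norm gam0) lerDr.
have -> : Ex P (fun w => sqnorm (ev t i w)) = Ex P Y.
  rewrite /Ex /Rintegral -(eZ setT) //; last by case: (F_sigma t) => F0 FD _;
    have := FD _ F0; rewrite setD0.
  congr fine; apply: ae_eq_integral => //; [exact/measurable_EFinP..|].
  move: Zg; apply: filterS => w Zw _; congr EFin.
  by rewrite /Y minEle Zw.
rewrite -[leRHS](Ex_cst P); apply: Ex_le => // [|w]; first exact: L1_cst.
by rewrite /Y ge_min lexx orbT.
Qed.

Let ev_L2 t i k : (1 <= t)%N -> L2 P (fun w => ev t i w 0 k).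
Proof.
move=> t1; have [le _] := ev_sq i t1; apply: L2_le le _ => // w.
exact: sqr_coord_le.
Qed.

Let x_coord t i w k : (1 <= t)%N ->
  x t.+1 i w 0 k = (1 - be t) * x t i w 0 k
    + be t * (\sum_j W t i j * x t j w 0 k + ev t i w 0 k)
    - al t * be t * g t i w 0 k.
Proof.
move=> t1; have [_ ->//] := xP; rewrite !mxE summxE.
by under eq_bigr do rewrite mxE.
Qed.

Let x_L2 t : (1 <= t)%N -> forall i k, L2 P (fun w => x t i w 0 k).
Proof.
elim: t => // -[_ _ i k|t IH _ i k].
  by apply: (L2_eq (f := fun=> 0)) (L2_cst P 0) => w; rewrite x1 mxE.
apply: L2_eq (fun w => esym (x_coord i w k (isT : (1 <= t.+1)%N))) _.
apply: L2B; last by apply/L2Z/g_L2_of_x => // k'; exact: IH.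
apply: L2D; apply: L2Z; first exact: IH.
apply: L2D; last exact: ev_L2.
by apply: L2_sum => j _; apply: L2Z; exact: IH.
Qed.

Let g_L2 t i k : (1 <= t)%N -> L2 P (fun w => g t i w 0 k).
Proof. by move=> t1; apply: g_L2_of_x => // k'; exact: x_L2. Qed.

Let wr i := r i 0.
Let xc t w (k : 'I_d) i := x t i w 0 k.

Let xbE t w k : xb t w 0 k = wavg wr (xc t w k).
Proof. by rewrite /xb /xbar summxE; apply: eq_bigr => i _; rewrite mxE. Qed.

Let xb_wrt t k : (1 <= t)%N -> measurable_wrt (F t) (fun w => xb t w 0 k).
Proof.
move=> t1; have -> : (fun w => xb t w 0 k) = (fun w => wavg wr (xc t w k)).
  by apply/funext => w; exact: xbE.
by apply: wrt_sum => i; apply: wrtZ; exact: x_wrt.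
Qed.

Let xb_L2 t k : (1 <= t)%N -> L2 P (fun w => xb t w 0 k).
Proof.
move=> t1; apply: L2_eq (fun w => esym (xbE t w k)) _.
by apply: L2_sum => i _; apply: L2Z; exact: x_L2.
Qed.

Let cL t w k := grad L (xb t w) 0 k.

Let cL_wrt t k : (1 <= t)%N -> measurable_wrt (F t) (fun w => cL t w k).
Proof. by move=> t1; apply: gradL_wrt => // k'; exact: xb_wrt. Qed.

Let cL_L2 t k : (1 <= t)%N -> L2 P (fun w => cL t w k).
Proof.
by move=> t1; apply: (gradL_L2 k t1) => k'; [exact: xb_wrt|exact: xb_L2].
Qed.

Let mixW t : (1 <= t)%N -> mixing wr (W t).
Proof.
move=> t1; have [/(_ t t1) [W0 W1 rW] _ _] := connP; split=> // [i|j].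
  have /matrixP/(_ i 0) := W1; rewrite !mxE => <-.
  by apply: eq_bigr => j _; rewrite mxE mulr1.
have /matrixP/(_ 0 j) := rW; rewrite !mxE => rWj; rewrite -[RHS]rWj.
by apply: eq_bigr => i _; rewrite mxE.
Qed.

Let L1_wsq (h : Omega -> 'I_n -> R) :
  (forall i, L2 P (fun w => h w i)) -> L1 P (fun w => wsq wr (h w)).
Proof. by move=> lh; apply: L1_sum => i _; apply: L1Z; exact: L2_sqr. Qed.

Let L1_disagreement t (h : Omega -> 'I_n -> R) :
  (forall i, L2 P (fun w => h w i)) ->
  L1 P (fun w => disagreement wr (W t) (h w)).
Proof.
move=> lh; apply: L1_sum => i _; apply: L1Z; apply: L1_sum => j _; apply: L1Z.
by apply: L2_sqr; exact: L2B.
Qed.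

Let disp t w k := wsq wr (fun i => xc t w k i - wavg wr (xc t w k)).
Let gdev t w k := wsq wr (fun i => g t i w 0 k - cL t w k).
Let esq t w k := wsq wr (fun i => ev t i w 0 k).
Let disag t w k := disagreement wr (W t) (xc t w k).

Let U t := \sum_k Ex P (fun w => disp t w k).
Let Q t := \sum_k Ex P (fun w => disag t w k).
Let Gm t := \sum_k Ex P (fun w => gdev t w k).

Let disp_L1 t k : (1 <= t)%N -> L1 P (fun w => disp t w k).
Proof.
move=> t1; apply: L1_wsq => i; apply: L2B; first exact: x_L2.
by apply: L2_sum => j _; apply: L2Z; exact: x_L2.
Qed.

Let disag_L1 t k : (1 <= t)%N -> L1 P (fun w => disag t w k).
Proof. by move=> t1; apply: L1_disagreement => i; exact: x_L2. Qed.

Let gdev_L1 t k : (1 <= t)%N -> L1 P (fun w => gdev t w k).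
Proof. by move=> t1; apply: L1_wsq => i; apply: L2B; [exact: g_L2|exact: cL_L2]. Qed.

Let esq_L1 t k : (1 <= t)%N -> L1 P (fun w => esq t w k).
Proof. by move=> t1; apply: L1_wsq => i; exact: ev_L2. Qed.

Let sum_wsq (h : 'I_n -> 'rV[R]_d) :
  \sum_k wsq wr (fun i => h i 0 k) = \sum_i wr i * sqnorm (h i).
Proof.
rewrite /wsq exchange_big; apply: eq_bigr => i _.
by rewrite /sqnorm mulr_sumr.
Qed.

Let esq_le t : (1 <= t)%N -> \sum_k Ex P (fun w => esq t w k) <= gamma.
Proof.
move=> t1; rewrite -Ex_sum => [|k _]; last exact: esq_L1.
rewrite (@Ex_eq _ _ _ _ _ (fun w => \sum_i wr i * sqnorm (ev t i w))) => [|w];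
  last exact: sum_wsq.
rewrite Ex_sum => [|i _]; last by apply: L1Z; case: (ev_sq i t1).
rewrite -[leRHS]mul1r -r_sum1 mulr_suml; apply: ler_sum => i _.
have [le hle] := ev_sq i t1.
by rewrite ExZ// ler_wpM2l// r_ge0.
Qed.

Let orth t i k (h : Omega -> R) : (1 <= t)%N -> measurable_wrt (F t) h ->
  L2 P h -> Ex P (fun w => h w * ev t i w 0 k) = 0.
Proof.
move=> t1 mh lh; have [_ _ _ /(_ t i k t1) ce _] := noiseP.
apply: cond_exp0_orth ce mh _ => //; apply: L2_mul => //; exact: ev_L2.
Qed.

(** The noise is orthogonal to the rest of the step, which is known before it is
    drawn: the cross term of [dispersion_step] has expectation zero. *)
Let U_step t th : (1 <= t)%N -> 0 < th ->
  U t.+1 <= (1 + th) * (U t - be t * (1 - be t) * Q t)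
    + (1 + th^-1) * (al t ^+ 2 * be t ^+ 2 * Gm t) + be t ^+ 2 * gamma.
Proof.
move=> t1 th0.
suff Uk k : Ex P (fun w => disp t.+1 w k) <=
  (1 + th) * (Ex P (fun w => disp t w k)
              - be t * (1 - be t) * Ex P (fun w => disag t w k))
  + (1 + th^-1) * (al t ^+ 2 * be t ^+ 2 * Ex P (fun w => gdev t w k))
  + be t ^+ 2 * Ex P (fun w => esq t w k).
  apply: le_trans (ler_sum _ (fun k _ => Uk k)) _.
  rewrite !big_split /= -!mulr_sumr sumrB -!mulr_sumr.
  by rewrite lerD2l ler_wpM2l ?sqr_ge0 ?esq_le.
pose m w i := (1 - be t) * (xc t w k i - wavg wr (xc t w k))
  + be t * (\sum_j W t i j * (xc t w k j - wavg wr (xc t w k)))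
  - al t * be t * (g t i w 0 k - cL t w k).
have wavg_wrt : measurable_wrt (F t) (fun w => wavg wr (xc t w k)).
  by apply: wrt_sum => i; apply: wrtZ; exact: x_wrt.
have wavg_L2 : L2 P (fun w => wavg wr (xc t w k)).
  by apply: L2_sum => j _; apply: L2Z; exact: x_L2.
have m_wrt i : measurable_wrt (F t) (fun w => m w i).
  apply: wrtB; last first.
    by apply: wrtZ; apply: wrtB; [exact: (g_wrt i k t1)|exact: (cL_wrt k t1)].
  apply: wrtD; first by apply: wrtZ; apply: wrtB => //; exact: x_wrt.
  by apply: wrtZ; apply: wrt_sum => j; apply: wrtZ; apply: wrtB => //; exact: x_wrt.
have m_L2 i : L2 P (fun w => m w i).
  apply: L2B; last by apply: L2Z; apply: L2B; [exact: g_L2|exact: cL_L2].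
  apply: L2D; first by apply: L2Z; apply: L2B => //; exact: x_L2.
  by apply: L2Z; apply: L2_sum => j _; apply: L2Z; apply: L2B => //; exact: x_L2.
pose me w := \sum_i wr i * (m w i * ev t i w 0 k).
have me_L1 : L1 P me.
  by apply: L1_sum => i _; apply: L1Z; apply: L2_mul => //; exact: ev_L2.
have me0 : Ex P me = 0.
  rewrite Ex_sum => [|i _]; last by apply: L1Z; apply: L2_mul => //; exact: ev_L2.
  apply: big1 => i _; rewrite ExZ ?orth ?mulr0//.
  by apply: L2_mul => //; exact: ev_L2.
pose bound w := (1 + th) * (disp t w k - be t * (1 - be t) * disag t w k)
  + (1 + th^-1) * (al t ^+ 2 * be t ^+ 2 * gdev t w k)
  + 2 * be t * me w + be t ^+ 2 * esq t w k.
have d1 := disp_L1 k t1; have d2 := disag_L1 k t1; have d3 := gdev_L1 k t1.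
have d4 := esq_L1 k t1.
have l2 := L1Z (be t * (1 - be t)) d2.
have l3 := L1Z (1 + th^-1) (L1Z (al t ^+ 2 * be t ^+ 2) d3).
have l12 := L1Z (1 + th) (L1B d1 l2).
have lme := L1Z (2 * be t) me_L1.
have le := L1Z (be t ^+ 2) d4.
have l123 := L1D l12 l3; have l1234 := L1D l123 lme.
have lbound : L1 P bound := L1D l1234 le.
have -> : (1 + th) * (Ex P (fun w => disp t w k)
              - be t * (1 - be t) * Ex P (fun w => disag t w k))
  + (1 + th^-1) * (al t ^+ 2 * be t ^+ 2 * Ex P (fun w => gdev t w k))
  + be t ^+ 2 * Ex P (fun w => esq t w k) = Ex P bound.
  rewrite (ExD l1234 le) (ExD l123 lme) (ExD l12 l3) (ExZ _ (L1B d1 l2)).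
  rewrite (ExB d1 l2) (ExZ _ d2) (ExZ _ (L1Z _ d3)) (ExZ _ d3) (ExZ _ me_L1).
  by rewrite (ExZ _ d4) me0 mulr0 addr0.
apply: Ex_le => // [|w]; first exact: disp_L1.
apply: (dispersion_step r_gt0 r_sum1 (mixW t1) th0 (m := m w)) => // i.
exact: x_coord.
Qed.

Let be_gt0 t : (1 <= t)%N -> 0 < be t.
Proof. by move=> t1; exact: step_beta_gt0. Qed.

Let be_le1 t : (1 <= t)%N -> be t <= 1.
Proof.
move=> t1; case/andP: (beta0_int) => _ b1.
by apply: le_trans (ltW b1); exact: step_beta_le.
Qed.

Let eta_gt0 : 0 < eta. Proof. by case: connP => _ []. Qed.

Let C1 : R := 2 + 32 * B%:R ^+ 2.

Let Q_ge0 t : (1 <= t)%N -> 0 <= Q t.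
Proof.
move=> t1; apply: sumr_ge0 => k _; apply: Ex_ge0 => w.
by apply: disagreement_ge0 (mixW t1).
Qed.

Let Gm_ge0 t : (1 <= t)%N -> 0 <= Gm t.
Proof. by move=> t1; apply: sumr_ge0 => k _; apply: Ex_ge0 => w; exact: wsq_ge0. Qed.

Let U_ge0 t : (1 <= t)%N -> 0 <= U t.
Proof. by move=> t1; apply: sumr_ge0 => k _; apply: Ex_ge0 => w; exact: wsq_ge0. Qed.

Let U_window t : (B.+2 <= t)%N ->
  poincare_const wr eta * U t <= \sum_(t - B <= s < t)
    C1 * (Q s + be s ^+ 2 * (gamma + al s ^+ 2 * Gm s)).
Proof.
move=> Bt; have t1 : (1 <= t)%N by exact: leq_trans Bt.
pose rhs s w k := 2 * disag s w k + 32 * B%:R ^+ 2 * (be s ^+ 2 *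
  (disag s w k + esq s w k + al s ^+ 2 * gdev s w k)).
have l1 s k : (1 <= s)%N ->
    L1 P (fun w => disag s w k + esq s w k + al s ^+ 2 * gdev s w k).
  move=> s1; apply: L1D; last by apply: L1Z; exact: gdev_L1.
  by apply: L1D; [exact: disag_L1|exact: esq_L1].
have rhs_L1 s k : (1 <= s)%N -> L1 P (fun w => rhs s w k).
  move=> s1; apply: L1D; first by apply: L1Z; exact: disag_L1.
  by apply: L1Z; apply: L1Z; exact: l1.
have ExR s k : (1 <= s)%N -> Ex P (fun w => rhs s w k) =
    2 * Ex P (fun w => disag s w k) + 32 * B%:R ^+ 2 * (be s ^+ 2 *
  (Ex P (fun w => disag s w k) + Ex P (fun w => esq s w k)
   + al s ^+ 2 * Ex P (fun w => gdev s w k))).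
  move=> s1; have a1 := disag_L1 k s1; have a2 := esq_L1 k s1.
  have a3 := gdev_L1 k s1; have a4 := l1 s k s1.
  rewrite (ExD (L1Z 2 a1) (L1Z (32 * B%:R ^+ 2) (L1Z (be s ^+ 2) a4))).
  rewrite (ExZ _ a1) (ExZ _ (L1Z _ a4)) (ExZ _ a4).
  by rewrite (ExD (L1D a1 a2) (L1Z _ a3)) (ExD a1 a2) (ExZ _ a3).
have s_ge1 (s : nat) : (t - B <= s < t)%N -> (1 <= s)%N.
  by case/andP => ts _; apply: leq_trans ts; rewrite subn_gt0 ltnW.
have Uk k : poincare_const wr eta * Ex P (fun w => disp t w k) <=
    \sum_(t - B <= s < t) Ex P (fun w => rhs s w k).
  rewrite -ExZ; last exact: disp_L1.
  (* the iterates at time 0 are arbitrary, and need not be integrable *)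
  pose rhs' s w := if (1 <= s)%N then rhs s w k else 0.
  have rhs'_L1 s : L1 P (rhs' s).
    by rewrite /rhs'; case s1: (1 <= s)%N; [exact: rhs_L1|exact: L1_cst].
  have -> : \sum_(t - B <= s < t) Ex P (fun w => rhs s w k) =
      \sum_(t - B <= s < t) Ex P (rhs' s).
    rewrite [LHS]big_nat_cond [RHS]big_nat_cond; apply: eq_bigr => s.
    by move=> /andP[/s_ge1 s1 _]; rewrite /rhs' s1.
  rewrite -Ex_sum => [|s _//]; apply: Ex_le => [| |w].
  - by apply: L1Z; exact: disp_L1.
  - exact: L1_sum.
  have -> : \sum_(t - B <= s < t) rhs' s w = \sum_(t - B <= s < t) rhs s w k.
    rewrite [LHS]big_nat_cond [RHS]big_nat_cond; apply: eq_bigr => s.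
    by move=> /andP[/s_ge1 s1 _]; rewrite /rhs' s1.
  have [_ [eta0 Weta] [_ conn]] := connP.
  apply: (dispersion_window_le r_gt0 r_sum1 (fun s => cL s w k)
    (x := fun s => xc s w k) (e := fun s i => ev s i w 0 k)
    (g := fun s i => g s i w 0 k)) => // s s1 i.
  exact: x_coord.
rewrite /U mulr_sumr; apply: le_trans (ler_sum _ (fun k _ => Uk k)) _.
rewrite exchange_big /= [leLHS]big_nat_cond [leRHS]big_nat_cond.
apply: ler_sum => s /andP[/s_ge1 s1 _].
under eq_bigr do rewrite ExR//.
rewrite !big_split /= -!mulr_sumr !big_split /= -mulr_sumr.
rewrite -/(Q s) -/(Gm s).
have hE := esq_le s1; set E := \sum_(_ < _) Ex P _ in hE *.
have q0 := Q_ge0 s1; have b1 := be_le1 s1; have b0 := be_gt0 s1.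
have bb : be s ^+ 2 <= 1 by rewrite expr_le1// ltW.
have X0 : 0 <= be s ^+ 2 * (gamma + al s ^+ 2 * Gm s).
  rewrite mulr_ge0 ?sqr_ge0// addr_ge0//; last by rewrite mulr_ge0 ?sqr_ge0 ?Gm_ge0.
  by case: noiseP => _ _ _ _ [/ltW].
have h1 : be s ^+ 2 * (Q s + E + al s ^+ 2 * Gm s) <=
    Q s + be s ^+ 2 * (gamma + al s ^+ 2 * Gm s).
  have := ler_wpM2l (sqr_ge0 (be s)) hE.
  by have := ler_wpM2r q0 bb; lra.
have c0 : 0 <= 32 * B%:R ^+ 2 :> R by rewrite mulr_ge0 ?sqr_ge0.
rewrite /C1 [leRHS]mulrDl; apply: lerD; last exact: ler_wpM2l.
by rewrite ler_wpM2l// lerDl.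
Qed.

Let xb_dist t w i k : (x t i w - xb t w) 0 k = xc t w k i - wavg wr (xc t w k).
Proof. by rewrite !mxE xbE. Qed.

Let sum_disp t w : \sum_k disp t w k = \sum_i wr i * sqnorm (x t i w - xb t w).
Proof.
rewrite -(sum_wsq (fun i => x t i w - xb t w)); apply: eq_bigr => k _.
by apply: eq_bigr => i _; rewrite xb_dist.
Qed.

Let ExU t : (1 <= t)%N ->
  L1 P (fun w => \sum_i wr i * sqnorm (x t i w - xb t w)) /\
  Ex P (fun w => \sum_i wr i * sqnorm (x t i w - xb t w)) = U t.
Proof.
move=> t1; have l1 : L1 P (fun w => \sum_k disp t w k).
  by apply: L1_sum => k _; exact: disp_L1.
split; first by apply: L1_eq l1 => w; exact: sum_disp.
rewrite /U -Ex_sum => [|k _]; last exact: disp_L1.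
by apply: Ex_eq => w; rewrite sum_disp.
Qed.

(** Inserting [grad L (x t i w)] separates the sampling variance from the distance
    to the average. *)
Let Gm_le t : (1 <= t)%N -> Gm t <= 2 * sigma ^+ 2 + 2 * (d%:R * H) * U t.
Proof.
move=> t1; have [lU EU] := ExU t1.
have ldev i j : L1 P (fun w => share i j * dev t i j w).
  have [ji|ji] := eqVneq (own j) i; first by apply: L1Z; case: (dev_L1 t1 ji).
  by apply: L1_eq (L1_cst P 0) => w; rewrite /share (negbTE ji) !mul0r.
pose Y w := \sum_i wr i * \sum_j share i j * dev t i j w.
have lY : L1 P Y by apply: L1_sum => i _; apply: L1Z; apply: L1_sum => j _.
have EY : Ex P Y <= sigma ^+ 2.
  rewrite Ex_sum => [|i _]; last by apply: L1Z; apply: L1_sum => j _.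
  rewrite -[leRHS]mul1r -r_sum1 mulr_suml; apply: ler_sum => i _.
  rewrite ExZ; last by apply: L1_sum => j _.
  rewrite ler_wpM2l ?r_ge0// Ex_sum => [|j _//].
  rewrite -[leRHS]mul1r -(share_sum1 i) mulr_suml; apply: ler_sum => j _.
  have [ji|ji] := eqVneq (own j) i.
    by have [lD hD] := dev_L1 t1 ji; rewrite ExZ// ler_wpM2l ?share_ge0.
  rewrite (@Ex_eq _ _ _ _ _ (fun=> 0)) => [|w].
    by rewrite Ex_cst mulr_ge0 ?sqr_ge0.
  by rewrite /share (negbTE ji) !mul0r.
have -> : Gm t = Ex P (fun w => \sum_k gdev t w k).
  by rewrite Ex_sum => // k _; exact: gdev_L1.
have lG : L1 P (fun w => \sum_k gdev t w k).
  by apply: L1_sum => k _; exact: gdev_L1.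
apply: (@le_trans _ _ (Ex P (fun w => 2 * Y w + 2 * (d%:R * H) *
    \sum_i wr i * sqnorm (x t i w - xb t w)))); last first.
  rewrite (ExD (L1Z _ lY) (L1Z _ lU)) (ExZ _ lY) (ExZ _ lU) EU.
  by rewrite lerD2r ler_wpM2l.
apply: Ex_le => // [|w]; first by apply: L1D; apply: L1Z.
have -> : \sum_k gdev t w k = \sum_i wr i * sqnorm (g t i w - grad L (xb t w)).
  rewrite -(sum_wsq (fun i => g t i w - grad L (xb t w))); apply: eq_bigr => k _.
  by apply: eq_bigr => i _; rewrite /cL !mxE.
rewrite /Y !mulr_sumr -big_split; apply: ler_sum => i _ /=.
rewrite !(mulrCA _ (wr i)) -mulrDr ler_wpM2l ?r_ge0//.
have -> : g t i w - grad L (xb t w) =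
    (g t i w - grad L (x t i w)) + (grad L (x t i w) - grad L (xb t w)).
  by rewrite addrA subrK.
apply: le_trans (sqnormD_le _ _) _; apply: lerD.
  rewrite ler_wpM2l//.
  have -> : g t i w - grad L (x t i w) =
      \sum_j share i j *: (gl j w (x t i w) - grad L (x t i w)).
    rewrite /g grad_floc; under [RHS]eq_bigr do rewrite scalerBr.
    by rewrite sumrB -scaler_suml share_sum1 scale1r.
  exact: sqnorm_wmean_le.
have := gradL_lip (x t i w) (xb t w); lra.
Qed.

Let U_summed : exists2 C : R, 0 <= C &
  forall T, psum (fun t => al t * be t * U t) T <=
    C * (1 + psum (fun t => al t ^+ 3 * be t) T).
Proof.
case/andP: (alpha0_int) => a00 a01; case/andP: (beta0_int) => b00 b01.
apply: (@summed_dispersion_le R U Q Gm al be B beta0 (poincare_const wr eta) C1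
  (2 * sigma ^+ 2) (2 * (d%:R * H)) gamma (beta0 / alpha0 ^+ 2)) => //.
- exact: poincare_const_gt0.
- by rewrite /C1 addr_ge0// mulr_ge0 ?sqr_ge0.
- by rewrite mulr_ge0 ?sqr_ge0.
- by rewrite mulr_ge0// mulr_ge0.
- by case: noiseP => _ _ _ _ [/ltW].
- by rewrite divr_ge0 ?exprn_ge0// ltW.
- by move=> t; exact: step_alpha_gt0.
- by move=> t; exact: step_alpha_dec.
- by move=> t; exact: step_beta_le.
- by move=> s t; exact: step_alphabeta_dec.
- by move=> t; exact: step_beta_le_alpha.
- by move=> de; exact: step_alpha_small.
Qed.

Let L1_lcomb (h : 'I_N -> Omega -> R) : (forall j, L1 P (h j)) ->
  L1 P (fun w => \sum_i r i 0 * (1 * \sum_j share i j * h j w)).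
Proof.
by move=> lh; apply: L1_sum => i _; do 2 apply: L1Z; apply: L1_sum => j _; apply: L1Z.
Qed.

Let wrt_lcomb t (h : 'I_N -> Omega -> R) : (forall j, measurable_wrt (F t) (h j)) ->
  measurable_wrt (F t) (fun w => \sum_i r i 0 * (1 * \sum_j share i j * h j w)).
Proof.
by move=> mh; apply: wrt_sum => i; do 2 apply: wrtZ; apply: wrt_sum => j; apply: wrtZ.
Qed.

Let L2_lcomb (h : 'I_N -> Omega -> R) : (forall j, L2 P (h j)) ->
  L2 P (fun w => \sum_i r i 0 * (1 * \sum_j share i j * h j w)).
Proof.
by move=> lh; apply: L2_sum => i _; do 2 apply: L2Z; apply: L2_sum => j _; apply: L2Z.
Qed.

Let f_lcomb w y : f w y = \sum_i r i 0 * (1 * \sum_j share i j * l y (xi j w)).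
Proof. by apply: eq_bigr => i _; rewrite -/(floc i w y) flocE. Qed.

Let gradf_lcomb w y k : grad (f w) y 0 k =
  \sum_i r i 0 * (1 * \sum_j share i j * gl j w y 0 k).
Proof.
rewrite grad_f summxE; apply: eq_bigr => i _; rewrite mxE grad_floc summxE mul1r.
by congr (_ * _); apply: eq_bigr => j _; rewrite mxE.
Qed.

Let f0_L1 : L1 P (fun w => f w 0).
Proof.
apply: L1_eq (fun w => esym (f_lcomb w 0)) _; apply: L1_lcomb => j.
have [_ /(_ j) dist] := sampleP; have [li _ _ _ _] := lossP.
exact: (law_L1 dist (li 0)).
Qed.

Let gradf0_L2 k : L2 P (fun w => grad (f w) 0 0 k).
Proof.
apply: L2_eq (fun w => esym (gradf_lcomb w 0 k)) _; apply: L2_lcomb => j.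
by case: (gradL_expectation j 0 k).
Qed.

Let gradf_wrt t (X : Omega -> 'rV[R]_d) k : (1 <= t)%N ->
  (forall k, measurable_wrt (F t) (fun w => X w 0 k)) ->
  measurable_wrt (F t) (fun w => grad (f w) (X w) 0 k).
Proof.
move=> t1 mX; have -> : (fun w => grad (f w) (X w) 0 k) =
    (fun w => \sum_i r i 0 * (1 * \sum_j share i j * gl j w (X w) 0 k)).
  by apply/funext => w; exact: gradf_lcomb.
by apply: wrt_lcomb => j; exact: gl_wrt.
Qed.

Let gradf_L2 t (X : Omega -> 'rV[R]_d) k : (1 <= t)%N ->
  (forall k, measurable_wrt (F t) (fun w => X w 0 k)) ->
  (forall k, L2 P (fun w => X w 0 k)) -> L2 P (fun w => grad (f w) (X w) 0 k).
Proof.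
move=> t1 mX lX.
apply: L2_le (L1D (L1Z (2 * H) (L1_sqnorm lX)) (L1Z 2 (L1_sqnorm gradf0_L2))) _.
  by apply: (@F_measurable t); exact: gradf_wrt.
move=> w; apply: le_trans (sqr_coord_le _ _) _.
have -> : grad (f w) (X w) = (grad (f w) (X w) - grad (f w) 0) + grad (f w) 0.
  by rewrite subrK.
apply: le_trans (sqnormD_le _ _) _; rewrite lerD2r -mulrA ler_wpM2l//.
by apply: le_trans (f_lip _ _ _) _; rewrite subr0.
Qed.

(** The second-order bound at zero dominates [f w (X w)] by integrable terms. *)
Let f_L1 t (X : Omega -> 'rV[R]_d) : (1 <= t)%N ->
  (forall k, measurable_wrt (F t) (fun w => X w 0 k)) ->
  (forall k, L2 P (fun w => X w 0 k)) -> L1 P (fun w => f w (X w)).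
Proof.
move=> t1 mX lX; have lS := L1_sqnorm lX; have lG := L1_sqnorm gradf0_L2.
apply: L1_le (L1D (L1D (L1_norm f0_L1) (L1Z 2^-1 (L1D lG lS)))
                  (L1Z ((H + 1) / 2) lS)) _.
  apply: (@F_measurable t).
  have -> : (fun w => f w (X w)) =
      (fun w => \sum_i r i 0 * (1 * \sum_j share i j * l (X w) (xi j w))).
    by apply/funext => w; exact: f_lcomb.
  by apply: wrt_lcomb => j; exact: l_wrt.
move=> w; have := smooth_taylor 0 (X w) H_ge0 (f_diff w) (f_lip w).
rewrite add0r => h1; have h2 := dotv_young (grad (f w) 0) (X w).
have -> : f w (X w) = f w 0 + dotv (grad (f w) 0) (X w)
    + (f w (X w) - f w 0 - dotv (grad (f w) 0) (X w)) by ring.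
apply: le_trans (ler_normD _ _) _; apply: lerD => //.
by apply: le_trans (ler_normD _ _) _; apply: lerD => //; rewrite mulrC.
Qed.

Let eb t w := \sum_i r i 0 *: ev t i w.
Let gb t w := \sum_i r i 0 *: g t i w.

Let eb_coord t w k : eb t w 0 k = \sum_i r i 0 * ev t i w 0 k.
Proof. by rewrite /eb summxE; apply: eq_bigr => i _; rewrite mxE. Qed.

Let gb_coord t w k : gb t w 0 k = \sum_i r i 0 * g t i w 0 k.
Proof. by rewrite /gb summxE; apply: eq_bigr => i _; rewrite mxE. Qed.

(** Mixing preserves the weighted average, which thus moves only under the
    averaged noise and gradients. *)
Let xb_step t w : (1 <= t)%N ->
  xb t.+1 w = xb t w + (be t *: eb t w - (al t * be t) *: gb t w).
Proof.
move=> t1; apply/rowP => k; rewrite !mxE -/(xb t w 0 k) -/(eb t w 0 k) -/(gb t w 0 k).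
rewrite -/(xb t.+1 w 0 k) !xbE eb_coord gb_coord.
have -> : wavg wr (xc t.+1 w k) =
   \sum_i ((1 - be t) * (wr i * xc t w k i)
     + be t * (wr i * \sum_j W t i j * xc t w k j)
     + be t * (r i 0 * ev t i w 0 k) - al t * be t * (r i 0 * g t i w 0 k)).
  by apply: eq_bigr => i _; rewrite /xc x_coord// /wr; ring.
rewrite sumrB !big_split /= -!mulr_sumr -[\sum_i wr i * _]/(wavg wr _).
have := wavg_mix (xc t w k) (mixW t1); rewrite /wavg => ->; ring.
Qed.

Let grad_gap t w : sqnorm (grad (f w) (xb t w) - gb t w) <=
  H * \sum_i wr i * sqnorm (x t i w - xb t w).
Proof.
rewrite grad_f /gb -sumrB; under eq_bigr do rewrite -scalerBr.
apply: le_trans (sqnorm_wmean_le _ r_ge0 r_sum1) _.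
rewrite mulr_sumr; apply: ler_sum => i _; rewrite mulrCA ler_wpM2l ?r_ge0//.
by rewrite sqnormBC floc_lip.
Qed.

Let V t := Ex P (fun w => f w (xb t w) - f w (xstar w)).
Let Gn t := Ex P (fun w => sqnorm (grad (f w) (xb t w))).
Let M t := Ex P (fun w => sqnorm (gb t w)).

Let V_ge0 t : 0 <= V t.
Proof. by apply: Ex_ge0 => w; rewrite subr_ge0; exact: xstar_min. Qed.

Let M_ge0 t : 0 <= M t.
Proof. by apply: Ex_ge0 => w; exact: sqnorm_ge0. Qed.

Let gradxb_L2 t k : (1 <= t)%N -> L2 P (fun w => grad (f w) (xb t w) 0 k).
Proof.
by move=> t1; apply: (gradf_L2 k t1) => k'; [exact: xb_wrt|exact: xb_L2].
Qed.

Let Gn_L1 t : (1 <= t)%N -> L1 P (fun w => sqnorm (grad (f w) (xb t w))).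
Proof. by move=> t1; apply: L1_sqnorm => k; exact: gradxb_L2. Qed.

Let Gn_ge0 t : 0 <= Gn t.
Proof. by apply: Ex_ge0 => w; exact: sqnorm_ge0. Qed.

Let descent t : (1 <= t)%N ->
  al t * be t * Gn t <= 2 * (V t - V t.+1) + al t * be t * (H * U t)
    + 2 * (H + 1) * be t ^+ 2 * gamma
    + (2 * (H + 1) * (al t * be t) ^+ 2 - al t * be t) * M t.
Proof.
move=> t1; have ab0 : 0 <= al t * be t.
  by rewrite mulr_ge0// ltW ?be_gt0//; exact: step_alpha_gt0.
have [lU EU] := ExU t1.
have lfx s : (1 <= s)%N -> L1 P (fun w => f w (xb s w)).
  by move=> s1; apply: (f_L1 s1) => k; [exact: xb_wrt|exact: xb_L2].
have lV s : (1 <= s)%N -> L1 P (fun w => f w (xb s w) - f w (xstar w)).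
  by move=> s1; apply: L1B; [exact: lfx|exact: xstar_int].
have leb : L1 P (fun w => sqnorm (eb t w)).
  apply: L1_sqnorm => k; apply: L2_eq (fun w => esym (eb_coord t w k)) _.
  by apply: L2_sum => i _; apply: L2Z; exact: ev_L2.
have Eeb : Ex P (fun w => sqnorm (eb t w)) <= gamma.
  apply: (@le_trans _ _ (Ex P (fun w => \sum_i r i 0 * sqnorm (ev t i w)))).
    apply: Ex_le => // [|w]; last exact: sqnorm_wmean_le.
    by apply: L1_sum => i _; apply: L1Z; case: (ev_sq i t1).
  rewrite Ex_sum => [|i _]; last by apply: L1Z; case: (ev_sq i t1).
  rewrite -[leRHS]mul1r -r_sum1 mulr_suml; apply: ler_sum => i _.
  by have [le hle] := ev_sq i t1; rewrite ExZ// ler_wpM2l.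
have lgb : L1 P (fun w => sqnorm (gb t w)).
  apply: L1_sqnorm => k; apply: L2_eq (fun w => esym (gb_coord t w k)) _.
  by apply: L2_sum => i _; apply: L2Z; exact: g_L2.
pose cross w := dotv (grad (f w) (xb t w)) (eb t w).
have crossE w : cross w =
    \sum_k \sum_i r i 0 * (grad (f w) (xb t w) 0 k * ev t i w 0 k).
  apply: eq_bigr => k _; rewrite eb_coord mulr_sumr.
  by apply: eq_bigr => i _; rewrite mulrCA.
have lke k i : L1 P (fun w => grad (f w) (xb t w) 0 k * ev t i w 0 k).
  by apply: L2_mul; [exact: gradxb_L2|exact: ev_L2].
have lcross : L1 P cross.
  apply: L1_eq (fun w => esym (crossE w)) _.
  by apply: L1_sum => k _; apply: L1_sum => i _; apply: L1Z.
have cross0 : Ex P cross = 0.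
  rewrite (Ex_eq P crossE) Ex_sum => [|k _]; last first.
    by apply: L1_sum => i _; apply: L1Z.
  apply: big1 => k _; rewrite Ex_sum => [|i _]; last exact: L1Z.
  apply: big1 => i _; rewrite ExZ// orth ?mulr0//; last exact: gradxb_L2.
  by apply: gradf_wrt => // k'; exact: xb_wrt.
(* coefficients of the noise and of the mean gradient in [smooth_descent] *)
pose c1 := 2 * (H + 1) * be t ^+ 2.
pose c2 := 2 * (H + 1) * (al t * be t) ^+ 2 - al t * be t.
pose rhs w := 2 * ((f w (xb t w) - f w (xstar w))
     - (f w (xb t.+1 w) - f w (xstar w))) + 2 * be t * cross w
    + al t * be t * (H * \sum_i wr i * sqnorm (x t i w - xb t w))
    + c1 * sqnorm (eb t w) + c2 * sqnorm (gb t w).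
have lVV := L1B (lV _ t1) (lV _ (isT : (1 <= t.+1)%N)).
have l1 := L1Z 2 lVV; have l2 := L1Z (2 * be t) lcross.
have l3' := L1Z H lU; have l3 := L1Z (al t * be t) l3'.
have l4 := L1Z c1 leb; have l5 := L1Z c2 lgb.
have l12 := L1D l1 l2; have l123 := L1D l12 l3; have l1234 := L1D l123 l4.
have lrhs : L1 P rhs := L1D l1234 l5.
apply: (@le_trans _ _ (Ex P rhs)); last first.
  rewrite (ExD l1234 l5) (ExD l123 l4) (ExD l12 l3) (ExD l1 l2) (ExZ _ lVV).
  rewrite (ExB (lV _ t1) (lV _ (isT : (1 <= t.+1)%N))) (ExZ _ lcross) cross0.
  rewrite (ExZ _ l3') (ExZ _ lU) EU (ExZ _ leb) (ExZ _ lgb) mulr0 addr0.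
  rewrite lerD2r lerD2l ler_wpM2l// /c1 mulr_ge0 ?sqr_ge0// mulr_ge0//.
  by rewrite addr_ge0.
rewrite /Gn -(ExZ _ (Gn_L1 t1)); apply: Ex_le => // [|w].
  by apply: L1Z; exact: Gn_L1.
have := smooth_descent (eb t w) (q := gb t w) H_ge0 (f_diff w) (f_lip w) ab0
  (grad_gap t w).
rewrite -xb_step// /rhs /c1 /c2 /cross; lra.
Qed.

Let Gn_summed : exists2 C : R, 0 <= C &
  forall T, psum (fun t => al t * be t * Gn t) T <=
    C * (1 + psum (fun t => al t ^+ 3 * be t) T).
Proof.
case/andP: (alpha0_int) => a00 a01; case/andP: (beta0_int) => b00 b01.
have [CU CU0 hU] := U_summed.
have gam0 : 0 <= gamma by case: noiseP => _ _ _ _ [/ltW].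
have H1 : 0 < H + 1 by rewrite ltr_wpDl.
pose c2 t := 2 * (H + 1) * (al t * be t) ^+ 2 - al t * be t.
(* once the steps are small, the weight of [M t] in [descent] has a good sign;
   the terms before [t0] go into the constant *)
have [t0 ht0] : exists t0, forall t, (t0 < t)%N -> c2 t <= 0.
  pose de := (2 * (H + 1) * (beta0 / alpha0 ^+ 2))^-1.
  have de1 : 0 < 2 * (H + 1) * (beta0 / alpha0 ^+ 2).
    by rewrite mulr_gt0 ?divr_gt0 ?exprn_gt0// mulr_gt0.
  have de0 : 0 < de by rewrite invr_gt0.
  have [t0 ht0] := step_alpha_small alpha0_int tau_ge0 de0.
  exists t0 => t tt; have t1 : (1 <= t)%N by exact: leq_ltn_trans tt.
  have al_0 : 0 < al t by exact: step_alpha_gt0.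
  have al_1 : al t <= 1 by exact: step_alpha_le1.
  have be_0 := be_gt0 t1.
  have h : 2 * (H + 1) * be t <= 1.
    apply: le_trans (_ : 2 * (H + 1) * (beta0 / alpha0 ^+ 2 * de) <= _).
      rewrite ler_wpM2l ?mulr_ge0 ?(ltW H1)//.
      apply: le_trans (step_beta_le_alpha alpha0_int beta0_int tau_ge0 t1) _.
      rewrite ler_wpM2l ?divr_ge0 ?exprn_ge0 ?(ltW a00) ?(ltW b00)//.
      exact: ht0.
    by rewrite mulrA /de divff// gt_eqF.
  have -> : c2 t = al t * be t * (al t * (2 * (H + 1) * be t) - 1).
    by rewrite /c2; ring.
  apply: mulr_ge0_le0; first exact: mulr_ge0 (ltW al_0) (ltW be_0).
  rewrite subr_le0 mulr_ile1 ?(ltW al_0)//.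
  by rewrite mulr_ge0 ?(ltW be_0)// mulr_ge0 ?(ltW H1).
pose lam t := al t ^+ 3 * be t.
have lam_ge0 t : (1 <= t)%N -> 0 <= lam t.
  move=> t1; rewrite mulr_ge0 ?exprn_ge0 ?(ltW (be_gt0 t1))//.
  by apply: ltW; exact: step_alpha_gt0.
pose N1 t := `|c2 t * M t|.
pose K1 := 2 * (H + 1) * (beta0 / alpha0 ^+ 3) * gamma.
have K10 : 0 <= K1.
  rewrite mulr_ge0// mulr_ge0 ?divr_ge0 ?exprn_ge0 ?(ltW b00) ?(ltW a00)//.
  by rewrite mulr_ge0 ?(ltW H1).
have N10 : 0 <= psum N1 t0 by apply: psum_ge0 => t _; exact: normr_ge0.
exists (2 * V 1%N + H * CU + K1 + psum N1 t0).
  by rewrite !addr_ge0// mulr_ge0.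
move=> T.
have L0 : 0 <= psum lam T by exact: psum_ge0.
have hN : psum (fun t => Num.max (c2 t * M t) 0) T <= psum N1 t0.
  apply: le_trans (@psum_split_le _ _ (fun=> 0) t0 T _ _ _) _.
  - by move=> t _; rewrite le_max lexx orbT.
  - by [].
  - by move=> t tt; rewrite ge_max lexx andbT mulr_le0_ge0 ?ht0.
  rewrite [X in _ + X](_ : _ = 0) ?addr0; last by rewrite /psum big1.
  by apply: psum_le => t _; rewrite ge_max ler_norm normr_ge0.
have tele : psum (fun t => al t * be t * Gn t) T + 2 * V T.+1 <=
    2 * V 1%N + (H * psum (fun t => al t * be t * U t) T + K1 * psum lam T
                 + psum (fun t => Num.max (c2 t * M t) 0) T).
  rewrite -!psumZ -!psumD; apply: psum_telescope_le => t t1.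
  apply: le_trans (descent t1) _; rewrite -/(c2 t) -!addrA lerD2l; apply: lerD.
    by rewrite mulrCA.
  apply: lerD; last by rewrite le_max lexx.
  rewrite /be (step_beta_sqr beta0 alpha0_int tau_ge0 t1) -/be /K1 /lam.
  by rewrite -!mulrA (mulrC gamma) !mulrA.
apply: (@le_trans _ _ (2 * V 1%N + (H * (CU * (1 + psum lam T))
                                   + K1 * psum lam T + psum N1 t0))).
  apply: le_trans (_ : _ <= psum (fun t => al t * be t * Gn t) T + 2 * V T.+1) _.
    by rewrite lerDl mulr_ge0.
  apply: (le_trans tele); rewrite lerD2l; apply: lerD => //.
  by rewrite lerD2r ler_wpM2l.
have := mulr_ge0 (V_ge0 1%N) L0; have := mulr_ge0 N10 L0.
rewrite -[psum (fun t => al t ^+ 3 * be t) T]/(psum lam T).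
move: (psum lam T) (psum N1 t0) (V 1%N) K1 K10 {tele hN L0 N10} => y N0 v K2 K20.
by lra.
Qed.

Lemma dimix_bigO (Y : nat -> Omega -> R) (a : nat -> R) (C eps : R) : 0 < eps ->
  (forall t, (1 <= t)%N -> L1 P (Y t) /\ Ex P (Y t) <= a t) ->
  (forall t, (1 <= t)%N -> 0 <= a t) -> 0 <= C ->
  (forall T, psum (fun t => al t * be t * a t) T <=
     C * (1 + psum (fun t => al t ^+ 3 * be t) T)) ->
  is_bigO (time_average P Y) (fun T => T%:R `^ (- (1 / 3) + eps)).
Proof.
move=> eps0 lY a0 C0 hC.
have [C' hC'] := average_rate alpha0_int beta0_int tau_ge0 eps0 a0 C0 hC.
exists C'; near=> T; have T1 : (1 <= T)%N by near: T; exact: nbhs_infty_ge.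
apply: le_trans (_ : (T%:R^-1 * psum a T)%:E <= _)%E; last by rewrite lee_fin hC'.
rewrite /time_average EFinM lee_wpmul2l ?lee_fin ?invr_ge0// /psum -sumEFin.
rewrite [leLHS]big_nat_cond [leRHS]big_nat_cond; apply: lee_sum => t.
by move=> /andP[/andP[t1 _] _]; have [lt ht] := lY t t1; rewrite Ex_EFin// lee_fin.
Unshelve. all: by end_near.
Qed.

Let cons_L1 t i : (1 <= t)%N -> L1 P (fun w => sqnorm (x t i w - xb t w)).
Proof.
move=> t1; apply: L1_sqnorm => k; apply: L2_eq (fun w => esym (xb_dist t w i k)) _.
apply: L2B; first exact: x_L2.
by apply: L2_sum => j _; apply: L2Z; exact: x_L2.
Qed.

Let cons_le t i : (1 <= t)%N ->
  Ex P (fun w => sqnorm (x t i w - xb t w)) <= (r i 0)^-1 * U t.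
Proof.
move=> t1; have [lU <-] := ExU t1; rewrite -(ExZ _ lU).
apply: Ex_le => [| |w]; [exact: cons_L1|exact: L1Z|].
rewrite ler_pdivlMl// (bigD1 i)//= lerDl sumr_ge0// => j _.
by rewrite mulr_ge0 ?sqnorm_ge0 ?r_ge0.
Qed.

Let psum_abZ (c : R) (a : nat -> R) T :
  psum (fun t => al t * be t * (c * a t)) T =
  c * psum (fun t => al t * be t * a t) T.
Proof. by rewrite -psumZ; apply: eq_bigr => t _; ring. Qed.

Lemma dimix_rates (eps : R) : 0 < eps ->
  let rate := fun T : nat => T%:R `^ (- (1 / 3) + eps) : R in
  [/\ is_bigO (time_average P
        (fun t w => sqnorm (grad (f w) (xbar r x t w)))) rate,
      forall i, is_bigO (time_average P
        (fun t w => sqnorm (x t i w - xbar r x t w))) rate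
    & forall i, is_bigO (time_average P
        (fun t w => sqnorm (grad (f w) (x t i w)))) rate].
Proof.
move=> eps0 rate; have [CG CG0 hG] := Gn_summed; have [CU CU0 hU] := U_summed.
split.
- apply: (dimix_bigO (a := Gn) eps0 _ _ CG0 hG) => t t1; last exact: Gn_ge0.
  by split=> //; exact: Gn_L1.
- move=> i; have ri0 : 0 <= (r i 0)^-1 by rewrite invr_ge0.
  apply: (dimix_bigO (a := fun t => (r i 0)^-1 * U t) (C := (r i 0)^-1 * CU) eps0).
  + by move=> t t1; split; [exact: cons_L1|exact: cons_le].
  + by move=> t t1; rewrite mulr_ge0 ?U_ge0.
  + by rewrite mulr_ge0.
  + by move=> T; rewrite psum_abZ -mulrA ler_wpM2l.
move=> i; have ri0 : 0 <= (r i 0)^-1 by rewrite invr_ge0.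
have c0 : 0 <= 2 * (H * (r i 0)^-1) by rewrite mulr_ge0// mulr_ge0.
apply: (dimix_bigO (a := fun t => 2 * Gn t + 2 * (H * (r i 0)^-1) * U t)
  (C := 2 * CG + 2 * (H * (r i 0)^-1) * CU) eps0).
- move=> t t1; have lG := Gn_L1 t1; have lC := cons_L1 i t1; split.
    apply: L1_sqnorm => k; apply: (gradf_L2 k t1) => k'; [exact: x_wrt|exact: x_L2].
  apply: (@le_trans _ _ (Ex P (fun w => 2 * sqnorm (grad (f w) (xb t w))
      + 2 * H * sqnorm (x t i w - xb t w)))).
    apply: Ex_le => [| |w].
    + apply: L1_sqnorm => k; apply: (gradf_L2 k t1) => k'; [exact: x_wrt|exact: x_L2].
    + by apply: L1D; apply: L1Z.
    rewrite -[grad (f w) (x t i w)](subrK (grad (f w) (xb t w))) addrC.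
    by apply: le_trans (sqnormD_le _ _) _; rewrite lerD2l -mulrA ler_wpM2l// f_lip.
  rewrite (ExD (L1Z _ lG) (L1Z _ lC)) (ExZ _ lG) (ExZ _ lC) lerD2l.
  have := ler_wpM2l (mulr_ge0 (ler0n R 2) H_ge0) (cons_le i t1).
  by rewrite !mulrA.
- by move=> t t1; rewrite addr_ge0// mulr_ge0 ?Gn_ge0 ?U_ge0.
- by rewrite addr_ge0// mulr_ge0.
move=> T.
have -> : psum (fun t => al t * be t * (2 * Gn t + 2 * (H * (r i 0)^-1) * U t)) T =
    2 * psum (fun t => al t * be t * Gn t) T +
    2 * (H * (r i 0)^-1) * psum (fun t => al t * be t * U t) T.
  by rewrite -!psum_abZ -psumD; apply: eq_bigr => t _; ring.
by rewrite [leRHS]mulrDl; apply: lerD; rewrite -[leRHS]mulrA ler_wpM2l.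
Qed.

End dimix_analysis.

Theorem proposition1
  (R : realType) (dO : measure_display) (Omega : measurableType dO)
  (P : probability Omega R) (d p n N : nat)
  (l : 'rV[R]_d -> 'rV[R]_p -> R) (Pxi : probability (borel_rV R p) R)
  (xi : 'I_N -> {RV P >-> borel_rV R p})
  (r : 'cV[R]_n) (own : 'I_N -> 'I_n) (W : nat -> 'M[R]_n)
  (F : nat -> set (set Omega))
  (e : nat -> 'I_n -> {RV P >-> borel_rV R d})
  (x : nat -> 'I_n -> Omega -> 'rV[R]_d)
  (xstar : Omega -> 'rV[R]_d)
  (alpha0 beta0 tau gamma eta K sigma : R) (B : nat)
  (n_ge2 : (2 <= n)%N) (N_gt0 : (0 < N)%N)
  (r_gt0 : forall i, 0 < r i 0) (r_sum1 : \sum_(i < n) r i 0 = 1)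
  (shardsP : forall i, (shard_size own i)%:R = r i 0 * N%:R)
  (sampleP : iid_sample Pxi xi)
  (xstar_min : forall w y,
    global_loss l r own (fun j => xi j w) (xstar w)
      <= global_loss l r own (fun j => xi j w) y)
  (xstar_int : P.-integrable setT
    (fun w => (global_loss l r own (fun j => xi j w) (xstar w))%:E))
  (alpha0_int : 0 < alpha0 < 1) (beta0_int : 0 < beta0 < 1) (tau_ge0 : 0 <= tau)
  (xP : dimix l own (fun w j => xi j w) W
          (step_alpha alpha0 tau) (step_beta beta0 tau) e x)
  (noiseP : noise_assumption xi F x e gamma)
  (connP : connectivity_assumption r W eta B)
  (lossP : loss_assumption l Pxi own xi x K sigma)
  (eps : R) (eps_gt0 : 0 < eps) :
  let f := fun w => global_loss l r own (fun j => xi j w) in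
  let rate := fun T : nat => T%:R `^ (- (1 / 3) + eps) : R in
  [/\ is_bigO (time_average P
        (fun t w => sqnorm (grad (f w) (xbar r x t w)))) rate,
      forall i, is_bigO (time_average P
        (fun t w => sqnorm (x t i w - xbar r x t w))) rate
    & forall i, is_bigO (time_average P
        (fun t w => sqnorm (grad (f w) (x t i w)))) rate].
Proof.
exact: (dimix_rates N_gt0 r_gt0 r_sum1 shardsP sampleP xstar_min xstar_int
  alpha0_int beta0_int tau_ge0 xP noiseP connP lossP eps_gt0).
Qed.
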